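(* Let $1\le k\le N$, $\mathcal{I}=\{i_1<\cdots<i_k\}\subset\{1,\ldots,N\}$, and let $a_{\mathcal{I}}=(a_{i_1}>\cdots>a_{i_k}\ge0)$ be an integer vector. Let $X_{\mathcal{I}}=(\ell_{i_1}>\cdots>\ell_{i_k})$ be the corresponding marginal of $X=(\ell_1>\cdots>\ell_N\ge 0)$ under the $\vec\beta$-tilted biorthogonal ensemble $\mathscr{M}_{\vec\beta}$. Put $$B_i(a)=\{0,1,\ldots,a-1\}\times\{i\},\qquad C_i(a)=\{a\}\times\{i\},\qquad F_{\mathcal{I}}(a_{\mathcal{I}})=\bigcup_{p=1}^k\bigl(B_{i_p}(a_{i_p})\cup C_{i_p}(a_{i_p})\bigr).$$ Then $$\mathscr{M}_{\vec\beta}(X_{\mathcal{I}}=a_{\mathcal{I}})=[z_1^{N-i_1}\cdots z_k^{N-i_k}\,w_1\cdots w_k]\ \det\Bigl(\mathbf{1}-\chi_{F_{\mathcal{I}}(a_{\mathcal{I}})}\sum_{p=1}^k(1-z_p)K^{2d}_{\vec\beta}\,\chi_{B_{i_p}(a_{i_p})}-\chi_{F_{\mathcal{I}}(a_{\mathcal{I}})}\sum_{p=1}^k(1-w_p)K^{2d}_{\vec\beta}\,\chi_{C_{i_p}(a_{i_p})}\Bigr).$$ Here $[\,\cdot\,]$ denotes taking the coefficient of the given monomial in a polynomial in $z_1,\ldots,z_k,w_1,\ldots,w_k$, and the determinant is that of a square matrix of size $\sum_{p=1}^k(a_{i_p}+1)$ with rows and columns indexed by $F_{\mathcal{I}}(a_{\mathcal{I}})$;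 it is a polynomial in the entries of $K^{2d}_{\vec\beta}$. Moreover, for any $k\ge1$ and any pairwise distinct $a_1,\ldots,a_k\in\mathbb{Z}_{\ge0}$, $$\mathscr{M}_{\vec\beta}(X\text{ contains }a_1,\ldots,a_k)=\sum_{\mathcal{I}=\{1\le i_1<\cdots<i_k\le N\}}\mathscr{M}_{\vec\beta}\bigl(X_{\mathcal{I}}=\{a_1,\ldots,a_k\}\bigr),$$ where $X_{\mathcal I}=\{a_1,\ldots,a_k\}$ means equality of sets, i.e. $X_{\mathcal I}$ equals the decreasing rearrangement of $(a_1,\ldots,a_k)$.
   Context: Let $N\ge1$, $\Phi_1,\ldots,\Phi_N,\Psi_1,\ldots,\Psi_N\colon\mathbb{Z}_{\ge0}\to\mathbb{C}$, $\beta_1,\ldots,\beta_{N-1}\in\mathbb{C}$. Operators on functions on $\mathbb{Z}_{\ge0}$: $D^{(r)}_kf(k)=f(k)-\beta_rf(k+1)$, $D^{(r)\dagger}_kf(k)=f(k)-\beta_rf(k-1)\mathbf{1}_{k\ge1}$; $D^{[a,b)}_k=D^{(a)}_k\cdots D^{(b-1)}_k$, $D^{[a,b)\dagger}_k=D^{(a)\dagger}_k\cdots D^{(b-1)\dagger}_k$ (identity if $a=b$). The $\vec\beta$-tilted biorthogonal ensemble is the normalized (possibly complex-valued) measure on $X=(\ell_1>\cdots>\ell_N\ge0)$, $\ell_j\in\mathbb{Z}$: $\mathscr{M}_{\vec\beta}(X)=\mathscr{W}_{\vec\beta}(X)/\mathscr{Z}_{\vec\beta}$ with $$\mathscr{W}_{\vec\beta}(X)=\det\bigl[D^{[1,j)}_{\ell_j}\Phi_i(\ell_j)\bigr]_{i,j=1}^N\det\bigl[D^{[j,N)\dagger}_{\ell_j}\Psi_i(\ell_j)\bigr]_{i,j=1}^N,\qquad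 \mathscr{Z}_{\vec\beta}=\sum_X\mathscr{W}_{\vec\beta}(X).$$ Let $T_\beta(x,y)=\mathbf{1}_{y=x}-\beta\,\mathbf{1}_{y=x-1}$ for $x,y\in\mathbb{Z}_{\ge0}$, let $(f*g)(x,y)=\sum_{u\ge0}f(x,u)g(u,y)$, and let $G(\vec\beta)=[G_{ij}(\vec\beta)]_{i,j=1}^N$, $G_{ij}(\vec\beta)=\sum_{k\ge0}\Psi_j(k)D^{[1,N)}_k\Phi_i(k)$. The kernel $K^{2d}_{\vec\beta}$ on $\mathbb{Z}_{\ge0}\times\{1,\ldots,N\}$ is $$K^{2d}_{\vec\beta}(x,t;y,s)=-\mathbf{1}_{t>s}(T_{\beta_s}*\cdots*T_{\beta_{t-1}})(y,x)+\sum_{i,j=1}^N\bigl(G(\vec\beta)^{-1}\bigr)_{ji}\,D^{[1,t)}_x\Phi_i(x)\,D^{[s,N)\dagger}_y\Psi_j(y).$$ In the determinant, $K^{2d}_{\vec\beta}$ is viewed as a matrix with rows $(x,t)$ and columns $(y,s)$, $\chi_A$ is the diagonal matrix of the indicator of $A$, and $\mathbf{1}$ is the identity matrix. Standing assumptions: all infinite series involved converge absolutely, and $\mathscr{Z}_{\vec\beta}\ne0$.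
   Formalization: Absolute convergence of G_ij is assumed for the fully expanded series, with |Φ_i|, |Ψ_j| and −|β_r| in place of Φ_i, Ψ_j and β_r; with only the displayed series in k converging absolutely, G may be singular although Z≠0 (N=2, β_1=1, Φ_1=Ψ_1=1, Φ_2=Ψ_2=δ_0). *)

(* Defs.v *)
From HB Require Import structures.
From mathcomp Require Import all_boot all_order all_algebra finmap.
From mathcomp Require Import complex.
From mathcomp Require Import -(notations) mpoly.
From mathcomp Require Import all_classical all_reals all_analysis.
From mathcomp Require Import showcase.summability.

Set Implicit Arguments.
Unset Strict Implicit.
Unset Printing Implicit Defensive.

Import Order.TTheory GRing.Theory Num.Theory.
Import numFieldNormedType.Exports.

Local Open Scope classical_set_scope.
Local Open Scope ring_scope.
Local Open Scope complex_scope.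

(* The levels 1, ..., N are represented by 'I_N: the ordinal i stands for the
   level i.+1.  The parameters beta are indexed as in the mathematical text,
   from 1; only beta 1, ..., beta N.-1 are ever used. *)

(* Unordered sum: the limit along finite subsets.  [esum.summable] is absolute
   summability, for extended-real families. *)
Definition csum (R : realType) (T : choiceType) (f : T -> R[i]) : R[i] :=
  summability.sum (fun x => f x : R[i]^o).

Definition abs_summable (R : realType) (T : choiceType) (f : T -> R[i]) : Prop :=
  esum.summable [set: T] (fun x => (ComplexField.Normc.normc (f x))%:E).

Definition decreasing k (a : {ffun 'I_k -> nat}) : bool :=
  [forall p : 'I_k, forall q : 'I_k, (p < q)%N ==> (a q < a p)%N].

Definition increasing k N (i : {ffun 'I_k -> 'I_N}) : bool :=
  [forall p : 'I_k, forall q : 'I_k, (p < q)%N ==> (i p < i q)%N].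

Definition config N := {X : {ffun 'I_N -> nat} | decreasing X}.

Definition marginal k N (i : {ffun 'I_k -> 'I_N}) (X : config N) :
  {ffun 'I_k -> nat} := [ffun p => val X (i p)].

Section Operators.
Variables (R : realType) (beta : nat -> R[i]).
Implicit Types (f : nat -> R[i]) (b : R[i]).

Definition Dop b f : nat -> R[i] := fun k => f k - b * f k.+1.

Definition Ddag b f : nat -> R[i] :=
  fun k => f k - b * f k.-1 * (1 <= k)%N%:R.

Definition Dint (a c : nat) f := foldr (fun r => Dop (beta r)) f (index_iota a c).

Definition Ddagint (a c : nat) f :=
  foldr (fun r => Ddag (beta r)) f (index_iota a c).

Definition Tbeta b : nat -> nat -> R[i] :=
  fun x y => (y == x)%:R - b * (y.+1 == x)%:R.

Definition kconv (f g : nat -> nat -> R[i]) : nat -> nat -> R[i] :=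
  fun x y => csum (fun u => f x u * g u y).

(* T_{beta_a} * ... * T_{beta_(c-1)}; the identity matrix ending the fold is
   neutral for kconv. *)
Definition Tint (a c : nat) : nat -> nat -> R[i] :=
  foldr (fun r => kconv (Tbeta (beta r))) (fun x y => (x == y)%:R)
    (index_iota a c).

End Operators.

Section Ensemble.
Variables (R : realType) (N : nat) (Phi Psi : 'I_N -> nat -> R[i]).
Variable beta : nat -> R[i].

Definition weight (X : config N) : R[i] :=
  \det (\matrix_(i, j) Dint beta 1 j.+1 (Phi i) (val X j)) *
  \det (\matrix_(i, j) Ddagint beta j.+1 N (Psi i) (val X j)).

Definition partition_function : R[i] := csum weight.

Definition measure_of (A : set (config N)) : R[i] :=
  csum (fun X => \1_A X * (weight X / partition_function)).

Definition Gram : 'M[R[i]]_N :=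
  \matrix_(i, j) csum (fun k => Psi j k * Dint beta 1 N (Phi i) k).

(* Since D^{[1,N)} Phi_i = Phi_i * T_{beta_1} * ... * T_{beta_(N-1)}, the entry
   G_ij is the multiple series over u_1, ..., u_N >= 0 of
     Phi_i(u_1) T_{beta_1}(u_1, u_2) ... T_{beta_(N-1)}(u_(N-1), u_N) Psi_j(u_N).
   The first condition is its absolute convergence: the inner sums of the
   absolute values of the terms are D^{[1,N)} |Phi_i| with the parameters
   - |beta_r|.  It implies absolute convergence of G_ij as a series in k, but is
   not implied by it: the terms of D^{[1,N)} Phi_i may cancel.  Such a
   cancellation can leave boundary terms at infinity in the summations by parts
   between D and its dual, and then Z may differ from det G. *)
Definition series_converge : Prop :=
  (forall i j : 'I_N, abs_summable (fun k =>
     `|Psi j k| * Dint (fun r => - `|beta r|) 1 N (fun l => `|Phi i l|) k)) /\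
  abs_summable weight.

(* The first argument is the row (x, t), the second the column (y, s). *)
Definition K2d (u v : nat * 'I_N) : R[i] :=
  let: (x, t) := u in let: (y, s) := v in
  - (s < t)%N%:R * Tint beta s.+1 t.+1 y x +
  \sum_(i < N) \sum_(j < N) invmx Gram j i *
    Dint beta 1 t.+1 (Phi i) x * Ddagint beta s.+1 N (Psi j) y.

End Ensemble.

Section Determinant.
Variables (R : realType) (N k : nat).
Variables (i : {ffun 'I_k -> 'I_N}) (a : {ffun 'I_k -> nat}).
Variable K : nat * 'I_N -> nat * 'I_N -> R[i].

Definition Bset (t : 'I_N) (c : nat) : {fset nat * 'I_N} :=
  [fset (x, t) | x in iota 0 c]%fset.

Definition Cset (t : 'I_N) (c : nat) : {fset nat * 'I_N} := [fset (c, t)]%fset.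

Definition Fset : {fset nat * 'I_N} :=
  (\bigcup_(p <- enum 'I_k) (Bset (i p) (a p) `|` Cset (i p) (a p)))%fset.

(* Polynomials in 2k variables: z_1, ..., z_k, then w_1, ..., w_k. *)
Definition zwpoly := mpoly (k + k) R[i].

Definition zvar (p : 'I_k) : zwpoly := mpolyX R[i] (mnm1 (lshift k p)).
Definition wvar (p : 'I_k) : zwpoly := mpolyX R[i] (mnm1 (rshift k p)).

Definition zwmonomial : multinom (k + k) :=
  Multinom [tuple match fintype.split q with
                  | inl p => (N - (i p).+1)%N
                  | inr _ => 1%N
                  end | q < k + k].

Definition Fpoint (u : 'I_#|{: Fset}|) : nat * 'I_N := val (enum_val u).

Definition Kmx : 'M[zwpoly]_#|{: Fset}| :=
  \matrix_(u, v) mpolyC (k + k) (K (Fpoint u) (Fpoint v)).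

Definition chi (A : {fset nat * 'I_N}) : 'M[zwpoly]_#|{: Fset}| :=
  diag_mx (\row_u (Fpoint u \in A)%:R).

Definition zwmatrix : 'M[zwpoly]_#|{: Fset}| :=
  1%:M
  - chi Fset *m (\sum_(p < k) (1 - zvar p) *: (Kmx *m chi (Bset (i p) (a p))))
  - chi Fset *m (\sum_(p < k) (1 - wvar p) *: (Kmx *m chi (Cset (i p) (a p)))).

End Determinant.

(* Main.v *)
(* Let g_t multiply functions on level t = i_p by z_p on [0, a_p), by w_p at a_p
   and by 1 above a_p, and let g_t = 1 on the other levels.  The determinant of
     G_g = [sum_x Phi_i(x) (g_1 T_1 g_2 T_2 ... T_(N-1) g_N Psi_j)(x)]_ij,
   with T_s = T_(beta_s), is evaluated in two ways.

   By Andreief's identity, N! det G_g is a sum over unordered x_1, ..., x_N of a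
   product of two determinants.  The levels are treated one after the other.  At
   level t the largest free variable becomes l_t.  Extracting the coefficient of
   z^(N-t) w forces l_t to be a_p if t = i_p: the columns of l_1, ..., l_(t-1)
   meet g_t only through multiples of column t.  Summation by parts in each free
   variable x < l_t then moves T_t from Psi to Phi; its boundary term, at x = l_t,
   repeats column t.  What remains in the end is the sum of the weights with
   l_(i_p) = a_p for all p.

   On the other hand, let Phi^(t) = Phi g_1 T_1 ... g_(t-1) T_(t-1).  Telescoping
   gives G_g = G - sum_t <Phi^(t), (1 - g_t) D^{[t,N)dagger} Psi>, and Phi^(t)
   solves (1 + U) Phi^(t) = D^{[1,t)} Phi, where U lowers the level.  Hence
   det G_g / det G is the determinant of the theorem, by det(1 - BC) = det(1 - CB).

   All this is done for x < M.  As M goes to infinity, absolute convergence removes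
   the boundary terms between D and its dual.  The case k = 0 yields Z = det G. *)
Require Import Defs.
From HB Require Import structures.
From mathcomp Require Import all_boot all_order all_algebra finmap.
From mathcomp Require Import complex.
From mathcomp Require Import -(notations) mpoly.
From mathcomp Require Import all_classical all_reals all_analysis.
From mathcomp Require Import perm ring zify.
From mathcomp Require Import showcase.summability.

Set Implicit Arguments.
Unset Strict Implicit.
Unset Printing Implicit Defensive.

Import Order.TTheory GRing.Theory Num.Theory.

Local Open Scope ring_scope.

(** * Shift operators *)

Section ShiftOperators.
Variable A : comNzRingType.
Implicit Types (b : A) (f h : nat -> A) (s : seq A).

Definition dop b f : nat -> A := fun n => f n - b * f n.+1.
Definition ddag b f : nat -> A := fun n => f n - b * f n.-1 * (1 <= n)%N%:R.
Definition dops s f := foldr dop f s.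
Definition ddags s f := foldr ddag f s.

Lemma dopC b c f : dop b (dop c f) = dop c (dop b f).
Proof.
by apply/funext => n; rewrite /dop; ring.
Qed.

Lemma dops_rcons s b f : dops (rcons s b) f = dop b (dops s f).
Proof.
rewrite /dops foldr_rcons; elim: s => //= c s ->.
by rewrite dopC.
Qed.

Lemma ddagB b f h :
  ddag b (fun n => f n - h n) = fun n => ddag b f n - ddag b h n.
Proof.
by apply/funext => n; rewrite /ddag; ring.
Qed.

Lemma ddagsB s f h :
  ddags s (fun n => f n - h n) = fun n => ddags s f n - ddags s h n.
Proof. by elim: s => //= b s ->; rewrite ddagB. Qed.

Lemma dop_lincomb b (I : finType) (f : I -> nat -> A) (c : I -> A) n :
  dop b (fun m => \sum_i f i m * c i) n = \sum_i dop b (f i) n * c i.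
Proof.
rewrite /dop mulr_sumr -sumrB; apply: eq_bigr => i _.
by rewrite mulrBl mulrA.
Qed.

Lemma ddag_lincomb b (I : finType) (f : I -> nat -> A) (c : I -> A) n :
  ddag b (fun m => \sum_i f i m * c i) n = \sum_i ddag b (f i) n * c i.
Proof.
rewrite /ddag mulr_sumr mulr_suml -sumrB; apply: eq_bigr => i _.
by rewrite mulrBl mulrA; congr (_ - _); rewrite -!mulrA [c i * _]mulrC.
Qed.

Lemma ddag0 f : ddag 0 f = f.
Proof. by apply/funext => n; rewrite /ddag !mul0r subr0. Qed.

(** At the lower end [ddag] has no left neighbour, so only the upper end leaves a boundary term. The
    indicator makes it vanish for the empty sum. *)
Lemma sum_by_parts b f h M :
  \sum_(n < M) f n * ddag b h n =
  \sum_(n < M) dop b f n * h n + b * f M * (h M.-1 * (0 < M)%N%:R).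
Proof.
elim: M => [|M IH]; first by rewrite !big_ord0 !mulr0 addr0.
by rewrite !big_ord_recr /= {}IH /ddag /dop; ring.
Qed.

Lemma sum_by_parts0 b f h M : (forall n, (M.-1 <= n)%N -> h n = 0) ->
  \sum_(n < M) f n * ddag b h n = \sum_(n < M) dop b f n * h n.
Proof. by move=> h0; rewrite sum_by_parts h0 // mul0r mulr0 addr0. Qed.

Lemma ddag_supp b h c : (forall n, (c <= n)%N -> h n = 0) ->
  forall n, (c < n)%N -> ddag b h n = 0.
Proof.
move=> h0 n cn; rewrite /ddag !h0 ?(ltnW cn) ?mulr0 ?mul0r ?subr0 //.
by rewrite -ltnS (ltn_predK cn).
Qed.

(* Only [f y] enters when [f] vanishes above [y] and each factor of [ddags]
   looks at most one step to the left. *)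
Lemma ddags_lowest s y x : (y + size s <= x)%N ->
  exists c, forall f, (forall u, (y < u)%N -> f u = 0) -> ddags s f x = c * f y.
Proof.
elim: s x => [|b s IH] x /=.
  rewrite addn0 leq_eqVlt => /orP[/eqP <-|yx]; first by exists 1 => f _;
    rewrite mul1r.
  by exists 0 => f ->; rewrite ?mul0r.
rewrite addnS => yx; have [c1 H1] := IH x (ltnW yx).
have [|c2 H2] := IH x.-1; first by rewrite -ltnS (ltn_predK yx).
exists (c1 - b * c2 * (1 <= x)%N%:R) => f fy.
by rewrite /ddag -/(ddags s f) H1 // H2 // mulrBl mulrA -!mulrA [f y * _]mulrC.
Qed.

End ShiftOperators.

(** * Ordered sums of products of determinants *)

Lemma card_geq N (t : 'I_N) : (\sum_(j : 'I_N | (t <= j)%N) 1 = N - t)%N.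
Proof.
rewrite -(big_mkord (fun q => t <= q)%N (fun=> 1%N)).
by rewrite -(big_nat_widenl _ _ _ predT) // sum_nat_const_nat muln1.
Qed.

Section OrderedSums.
Variables (A : comNzRingType) (N M : nat).
Local Notation conf := {ffun 'I_N -> 'I_M.+1}.

(** Andreief's identity. In each Leibniz term of the first determinant a permutation of the
    coordinates absorbs the sign into the second one, so all [N!] terms are equal; the remaining sum
    factorizes over the coordinates. *)
Lemma sum_det_det (F H : 'I_N -> nat -> A) :
  \sum_(x : conf)
     \det (\matrix_(i, j) F i (x j)) * \det (\matrix_(i, j) H i (x j)) =
  N`!%:R * \det (\matrix_(i, j) \sum_(v < M.+1) F i v * H j v).
Proof.
transitivity (\sum_(s : 'S_N) \sum_(x : conf)
  (\prod_j F j (x j)) * \det (\matrix_(i, j) H i (x j))).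
  rewrite [RHS](eq_bigr (fun s : 'S_N => \sum_(x : conf)
    (\prod_j F j (x (s j))) * \det (\matrix_(i, j) H i (x (s j))))); last first.
    move=> s _; rewrite (reindex_inj (h :=
      fun x : conf => [ffun j => x (s j)])).
      by apply: eq_bigr => x _; congr (_ * _); [apply: eq_bigr => j _|
        congr (\det _); apply/matrixP => i j; rewrite !mxE]; rewrite ffunE.
    move=> x y /ffunP xy; apply/ffunP => j.
    by have := xy (s^-1 j)%g; rewrite !ffunE permKV.
  rewrite [RHS]exchange_big; apply: eq_bigr => x _.
  rewrite {1}/determinant mulr_suml; apply: eq_bigr => s _.
  rewrite (_ : \matrix_(i, j) H i (x (s j)) =
    col_perm s (\matrix_(i, j) H i (x j)));
    last by apply/matrixP => i j; rewrite !mxE.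
  rewrite col_permE det_mulmx det_perm odd_permV -[LHS]mulrA [LHS]mulrC
    -[LHS]mulrA.
  by under eq_bigr do rewrite mxE.
rewrite sumr_const card_Sn -[LHS]mulr_natl; congr (_ * _).
under eq_bigr do rewrite -det_tr /determinant mulr_sumr.
rewrite exchange_big; apply: eq_bigr => s _ /=.
transitivity (\sum_(x : conf) (-1) ^+ s * \prod_i (F i (x i) * H (s i) (x i))).
  apply: eq_bigr => x _; rewrite mulrCA -big_split; congr (_ * _).
  by apply: eq_bigr => i _; rewrite !mxE.
rewrite -mulr_sumr; congr (_ * _).
rewrite -(bigA_distr_bigA (fun i v => F i (nat_of_ord v) * H (s i) v)).
by apply: eq_bigr => i _; rewrite !mxE.
Qed.

(** Interpolates between arbitrary tuples ([t = 0]) and strictly decreasing ones ([t = N]): the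
    coordinates from [t] on are unordered among themselves. *)
Definition desc t (x : conf) : bool :=
  [forall p : 'I_N, forall q : 'I_N, (p < t)%N && (p < q)%N ==> (x q < x p)%N].

Lemma descP t (x : conf) :
  reflect (forall p q : 'I_N, (p < t)%N -> (p < q)%N -> (x q < x p)%N)
    (desc t x).
Proof.
apply: (iffP forallP) => [H p q pt pq|H p]; last first.
  by apply/forallP => q; apply/implyP => /andP[]; exact: H.
by have /forallP /(_ q) /implyP := H p; apply; rewrite pt.
Qed.

Definition swapc (p q : 'I_N) (x : conf) : conf := [ffun j => x (tperm p q j)].

(** Since [F] vanishes at ties, the largest coordinate among those from [t] on may be taken to sit
    at a unique position [q]. Exchanging [q] and [t] shows that the [N - t] positions contribute
    equally. *)
Lemma sum_desc_max (t : 'I_N) (E : pred conf) (F : conf -> A) :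
  (forall (p q : 'I_N) (x : conf), (t <= p)%N -> (t <= q)%N -> F (swapc p q x) =
    F x) ->
  (forall (p q : 'I_N) (x : conf), (t <= p)%N -> (t <= q)%N -> E (swapc p q x) =
    E x) ->
  (forall (p q : 'I_N) (x : conf), (t <= p)%N -> (t <= q)%N -> p != q -> x p =
    x q -> F x = 0) ->
  \sum_(x | desc t x && E x) F x =
  (N - t)%:R * \sum_(x | desc t.+1 x && E x) F x.
Proof.
move=> Fsw Esw Fvan.
pose mx q (x : conf) :=
  [forall r : 'I_N, (t <= r)%N && (r != q) ==> (x r < x q)%N].
have mxP q (x : conf) : reflect (forall r : 'I_N, (t <= r)%N -> r != q ->
  (x r < x q)%N) (mx q x).
  apply: (iffP forallP) => [H r tr rq|H r]; last first.
    by apply/implyP => /andP[]; exact: H.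
  by have /implyP := H r; apply; rewrite tr.
have uniqmax (x : conf) : F x = \sum_(q : 'I_N | (t <= q)%N && mx q x) F x.
  have [q tq qmax] := @arg_maxnP 'I_N t (fun r => (t <= r)%N) (fun r => x r)
    (leqnn t).
  have {}qmax (r : 'I_N) : (t <= r)%N -> (x r <= x q)%N by apply: qmax.
  have [/forallP nF|] := boolP [forall r : 'I_N, (t <= r)%N && (r != q) ==>
    (x r != x q)].
    rewrite (bigD1 q) /=; last first.
      rewrite tq; apply/mxP => r tr rq; rewrite ltn_neqAle qmax // andbT.
      by have /implyP := nF r; rewrite tr; apply.
    rewrite big1 ?addr0 // => r /andP[/andP[tr /mxP rmx] rq].
    by have := rmx q tq; rewrite eq_sym => /(_ rq); rewrite ltnNge qmax.
  rewrite negb_forall => /existsP[r];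
    rewrite negb_imply negbK => /andP[/andP[tr rq] /eqP xrq].
  by rewrite (Fvan r q) // big1.
under eq_bigr do rewrite uniqmax.
rewrite (exchange_big_dep (fun q : 'I_N => (t <= q)%N)) /=;
  last by move=> x q _ /andP[].
rewrite (eq_bigr (fun=> \sum_(x | desc t.+1 x && E x) F x)); last first.
  move=> q tq.
  have swK : involutive (swapc t q).
    by move=> x; apply/ffunP => j; rewrite !ffunE tpermK.
  rewrite [RHS](reindex_inj (inv_inj swK)) /=; apply: eq_big => [x|x _];
    last by rewrite Fsw.
  rewrite Esw // tq /=; rewrite andbAC; congr (_ && _).
  apply/andP/descP => [[/descP dx /mxP mxq] p r pt pr|H].
    rewrite !ffunE; move: pt; rewrite ltnS leq_eqVlt => /orP[/eqP pt|pt].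
      have -> : p = t by exact: val_inj.
      rewrite tpermL; apply: mxq.
        by case: tpermP => // *; rewrite -pt ltnW.
      apply/eqP => /(canRL (tpermK t q)); rewrite tpermR => rt.
      by move: pr; rewrite rt pt ltnn.
    rewrite [tperm t q p]tpermD; last first.
      - by apply: contraTneq pt => <-; rewrite -leqNgt.
      - by apply: contraTneq pt => <-; rewrite ltnn.
    apply: dx => //; case: tpermP => [rt|rq|//]; last exact: (leq_trans pt).
    exact: (leq_trans pt).
  split; last first.
    apply/mxP => r tr rq; have := H t (tperm t q r) (ltnSn _).
    rewrite !ffunE tpermL tpermK; apply.
    case: tpermP => [rt||rt' rq']; last 2 first.
    - by move=> rq'; rewrite rq' eqxx in rq.
    - by rewrite ltn_neqAle tr andbT; apply/eqP => /val_inj; apply: nesym.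
    by rewrite ltn_neqAle tq andbT; apply: contraNneq rq => /val_inj <-;
      rewrite rt.
  apply/descP => p r pt pr.
  have := H p (tperm t q r) (ltnW pt);
    rewrite !ffunE tpermK [tperm t q p]tpermD; last first.
  - by apply: contraTneq pt => <-; rewrite -leqNgt.
  - by apply: contraTneq pt => <-; rewrite ltnn.
  apply; case: tpermP => [rt|rq|//]; last exact: pt.
  exact: (leq_trans pt).
rewrite sumr_const -[LHS]mulr_natl; congr (_%:R * _).
by rewrite -sum1_card card_geq.
Qed.

End OrderedSums.

(** * Summation by parts and removal of gates inside ordered sums *)

Section ColumnMoves.
Variables (A : comNzRingType) (N M : nat).
Local Notation conf := {ffun 'I_N -> 'I_M.+1}.

Definition updc q v (x : conf) : conf := [ffun j => if j == q then v else x j].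

(** Each line in direction [q] is represented by its point with [x q] equal to 0. *)
Lemma sum_coord (q : 'I_N) (F : conf -> A) :
  \sum_x F x = \sum_(x : conf | x q == ord0) \sum_v F (updc q v x).
Proof.
rewrite pair_big_dep /=.
rewrite (reindex_onto (fun p : conf * 'I_M.+1 => updc q p.2 p.1)
  (fun x => (updc q ord0 x, x q))) /=; last first.
  by move=> x _; apply/ffunP => j; rewrite !ffunE; case: eqP => // ->.
apply: eq_bigl => -[x v] /=; rewrite andbT xpair_eqE !ffunE eqxx eqxx andbT.
apply/eqP/eqP => [/ffunP /(_ q)|xq]; first by rewrite !ffunE eqxx.
by apply/ffunP => j; rewrite !ffunE; case: eqP => // ->.
Qed.

(** Laplace expansion along column [q]: the cofactors do not see the coordinate [x q], so the
    determinant is a fixed linear combination of the values [f i v]. *)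
Lemma det_updc (p : 'I_N -> 'I_N -> nat -> A) (f : 'I_N -> nat -> A) q v
  (x : conf) :
  \det (\matrix_(i, j) (if j == q then f i else p i j) (updc q v x j)) =
  \sum_i f i v * cofactor (\matrix_(i, j) p i j (x j)) i q.
Proof.
rewrite (expand_det_col _ q); apply: eq_bigr => i _.
rewrite !mxE ffunE eqxx; congr (_ * (_ * \det _)).
by apply/matrixP => k l; rewrite !mxE ffunE eq_sym (negPf (neq_lift _ _)).
Qed.

Lemma det_eq_col n (B : 'M[A]_n) (j k : 'I_n) :
  j != k -> (forall i, B i j = B i k) -> \det B = 0.
Proof.
move=> jk Bjk; rewrite -det_tr; apply: (determinant_alternate jk) => i.
by rewrite !mxE.
Qed.

(* Summation by parts in the coordinate [x q], which ranges over [0, x t); the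
   boundary term carries [p i q (x t)] in column [q] and so repeats column [t]. *)
Lemma move_column (t q : 'I_N) (E : pred conf) b
  (p r : 'I_N -> 'I_N -> nat -> A)
    (h : 'I_N -> nat -> A) :
  (t < q)%N -> (forall x v, E (updc q v x) = E x) ->
    (forall i, p i q = p i t) ->
  \sum_(x : conf | desc t.+1 x && E x)
     \det (\matrix_(i, j) p i j (x j)) *
     \det (\matrix_(i, j) (if j == q then ddag b (h i) else r i j) (x j)) =
  \sum_(x : conf | desc t.+1 x && E x)
     \det (\matrix_(i, j) (if j == q then dop b (p i q) else p i j) (x j)) *
     \det (\matrix_(i, j) (if j == q then h i else r i j) (x j)).
Proof.
move=> tq HE pqt; rewrite big_mkcond (sum_coord q) [RHS]big_mkcond
  [RHS](sum_coord q).
apply: eq_bigr => x _.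
(* The part of the ordering that does not involve [x q]. Given it, [x q < x t] implies the remaining
   constraints, because [x t < x k] for [k < t]. *)
pose C0 := [forall k : 'I_N, forall l : 'I_N,
  [&& (k < t.+1)%N, (k < l)%N & l != q] ==> (x l < x k)%N].
have tNq : (t == q) = false by apply: contraTF tq => /eqP ->; rewrite ltnn.
have dE v : desc t.+1 (updc q v x) = C0 && (v < x t)%N.
  apply/descP/andP => [H|[/forallP H vx] k l kt kl].
    split; last by have := H t q (ltnSn _) tq; rewrite !ffunE eqxx tNq.
    apply/forallP => k; apply/forallP => l; apply/implyP => /and3P[kt kl lq].
    have := H k l kt kl; rewrite !ffunE (negPf lq) ifN //.
    by apply: contraTneq kt => ->; rewrite ltnS -ltnNge.
  have kq : (k == q) = false.
    by apply: contraTF kt => /eqP ->; rewrite ltnS -ltnNge.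
  rewrite !ffunE kq; case: eqP => [lq|/eqP lq].
    move: kt; rewrite ltnS leq_eqVlt => /orP[/eqP/val_inj -> //|kt].
    apply: (ltn_trans vx); have /forallP /(_ t) /implyP := H k; apply.
    by rewrite ltnS ltnW // kt tNq.
  by have /forallP /(_ l) /implyP := H k; apply; rewrite kt kl lq.
under eq_bigr do rewrite dE HE.
under [RHS]eq_bigr do rewrite dE HE.
have [Cx|] := boolP (C0 && E x); last first.
  move=> nC; rewrite !big1 // => v _;
    by case: ifP => // /andP[/andP[c _] e]; rewrite c e in nC.
have /andP[-> ->] := Cx; rewrite /= -big_mkcond -[RHS]big_mkcond.
under eq_bigl do rewrite andbT; under [RHS]eq_bigl do rewrite andbT.
pose c i := cofactor (\matrix_(i, j) p i j (x j)) i q.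
pose d i := cofactor (\matrix_(i, j) r i j (x j)) i q.
have xt : (x t <= M.+1)%N by exact: ltnW.
transitivity (\sum_(v < x t) (\sum_i p i q v * c i) *
                ddag b (fun n => \sum_i h i n * d i) v).
  rewrite (big_ord_widen M.+1 (fun v => (\sum_i p i q v * c i) *
                ddag b (fun n => \sum_i h i n * d i) v)) //.
  apply: eq_bigr => v _; rewrite det_updc ddag_lincomb; congr (_ * _).
  rewrite -(det_updc p (fun i => p i q) q v x); congr (\det _).
  by apply/matrixP => i j; rewrite !mxE; case: eqP => // ->.
rewrite (sum_by_parts b (fun n => \sum_i p i q n * c i)) /=.
have -> : \sum_i p i q (x t) * c i = 0.
  rewrite -(det_updc p (fun i => p i q) q (x t) x);
    apply: (@det_eq_col _ _ t q).
    by rewrite tNq.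
  by move=> i; rewrite !mxE eqxx !ffunE eqxx tNq pqt.
rewrite mulr0 mul0r addr0.
rewrite (big_ord_widen M.+1 (fun v => dop b (fun n => \sum_i p i q n * c i) v *
                (\sum_i h i v * d i))) //.
by apply: eq_bigr => v _; rewrite !det_updc dop_lincomb.
Qed.

(* In the column operation below only the lowest point [x t] of the columns
   [j <= t] meets a nontrivial value of [g]. *)
Lemma det_gauge (t : 'I_N) (x : 'I_N -> nat) (g : nat -> A)
    (u : 'I_N -> nat -> A) (s : 'I_N -> seq A) :
  (forall j : 'I_N, (j < t)%N -> (x t + size (s j) <= x j)%N) ->
  (forall j : 'I_N, (t <= j)%N -> s j = [::]) ->
  (forall v, (x t < v)%N -> g v = 1) ->
  \det (\matrix_(i, j) ddags (s j) (fun v => g v * u i v) (x j)) =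
  (\prod_(j : 'I_N | (t <= j)%N) g (x j)) *
  \det (\matrix_(i, j) ddags (s j) (u i) (x j)).
Proof.
move=> xs s0 g1.
have /choice[c Hc] : forall j : 'I_N, exists c, (j < t)%N -> forall f,
    (forall v, (x t < v)%N -> f v = 0) -> ddags (s j) f (x j) = c * f (x t).
  move=> j; have [jt|_] := ltnP j t; last by exists 0.
  by have [c Hc] := ddags_lowest (xs j jt); exists c.
(* Right multiplication by [B] scales the columns [j >= t] by [g (x j)] and adds a multiple of
   column [t] to each column [j < t]. [B] is lower triangular, so its determinant is the product of
   the gates. *)
pose B : 'M[A]_N := \matrix_(k, j) if (j < t)%N
  then (k == j)%:R + (k == t)%:R * (c j * (g (x t) - 1)) else (k == j)%:R * g
    (x j).
have -> : \matrix_(i, j) ddags (s j) (fun v => g v * u i v) (x j) =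
          (\matrix_(i, j) ddags (s j) (u i) (x j)) *m B.
  apply/matrixP => i j; rewrite !mxE.
  under eq_bigr do rewrite !mxE.
  have [jt|tj] := ltnP j t.
    under eq_bigr do rewrite mulrDr mulrA.
    rewrite big_split /= (bigD1 j) //= eqxx mulr1 big1 ?addr0; last first.
      by move=> k /negPf ->; rewrite mulr0.
    rewrite (bigD1 t) //= eqxx mulr1 big1 ?addr0; last first.
      by move=> k /negPf ->; rewrite mulr0 mul0r.
    (* The function [(g - 1) * u i] vanishes above [x t], so its image under [ddags (s j)] is [c j]
       times its value at [x t]. *)
    rewrite (s0 t) //= [_ * (c j * _)]mulrC -mulrA
      -(Hc j jt (fun v => (g v - 1) * u i v)).
      rewrite -[LHS](subrK (ddags (s j) (u i) (x j))) addrC; congr (_ + _).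
      move/(congr1 (fun f => f (x j))):
        (ddagsB (s j) (fun v => g v * u i v) (u i)).
      move=> /= <-; congr (ddags _ _ _); apply/funext => v.
      by rewrite mulrBl mul1r.
    by move=> v /g1 ->; rewrite subrr mul0r.
  rewrite (bigD1 j) //= eqxx mul1r big1 ?addr0; last first.
    by move=> k /negPf ->; rewrite mul0r mulr0.
  by rewrite s0 //= mulrC.
rewrite det_mulmx mulrC; congr (_ * _).
rewrite det_trig; last first.
  apply/is_trig_mxP => k j kj; rewrite !mxE.
  have kNj : (k == j) = false by apply: contraTF kj => /eqP ->; rewrite ltnn.
  rewrite kNj mul0r add0r; case: ifP => // jt.
  suff -> : (k == t) = false by rewrite mul0r.
  by rewrite -val_eqE ltn_eqF // (ltn_trans kj jt).
rewrite [RHS]big_mkcond; apply: eq_bigr => j _; rewrite !mxE eqxx mul1r.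
by have [jt|//] := ltnP j t; rewrite -val_eqE ltn_eqF //= mul0r addr0.
Qed.

End ColumnMoves.

(** * Determinants and dressed functions *)

Section FiniteDeterminants.
Variable A : comNzRingType.

(** A permutation preserves the sum of the levels. Unless it is the identity, it therefore moves
    some [u] without lowering its level, and its Leibniz term has the factor 0 at that [u]. *)
Lemma det_one_strict n (lev : 'I_n -> nat) (U : 'M[A]_n) :
  (forall u v, (lev u <= lev v)%N -> U u v = 0) -> \det (1%:M + U) = 1.
Proof.
move=> U0; rewrite /determinant (bigD1 (1%g : 'S_n)) //= odd_perm1 mul1r.
rewrite big1 => [|u _]; last by rewrite !mxE perm1 eqxx U0 ?addr0.
rewrite big1 ?addr0 // => s s1.
have [/existsP[u /andP[su lu]]|] :=
    boolP [exists u, (s u != u) && (lev u <= lev (s u))%N].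
  by rewrite (bigD1 u) //= !mxE eq_sym (negPf su) U0 // addr0 mul0r mulr0.
rewrite negb_exists => /forallP H; case/negP: s1; apply/eqP/permP => u;
  rewrite perm1.
apply/eqP; apply: contraT => su.
have le v : (lev (s v) <= lev v)%N.
  by have := H v; rewrite negb_and negbK -ltnNge => /orP[/eqP ->|/ltnW].
have : (\sum_v lev (s v) < \sum_v lev v)%N.
  rewrite (bigD1 u) //= [X in (_ < X)%N](bigD1 u) //= -addSn; apply: leq_add.
    by have := H u; rewrite su /= -ltnNge.
  exact: leq_sum.
by rewrite [X in (_ < X)%N](reindex_inj (@perm_inj _ s)) /= ltnn.
Qed.

(** Sylvester's identity: both sides are the determinant of the block matrix with rows [1, B] and
    [C, 1], factorized in two ways. *)
Lemma det_one_subC m n (B : 'M[A]_(m, n)) (C : 'M[A]_(n, m)) :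
  \det (1%:M - B *m C) = \det (1%:M - C *m B).
Proof.
have e1 : block_mx 1%:M B C 1%:M =
    block_mx 1%:M 0 C 1%:M *m block_mx 1%:M B 0 (1%:M - C *m B) :>
      'M[A]_(m + n).
  by rewrite mulmx_block ?(mul1mx, mul0mx, mulmx0, mulmx1) ?(addr0, add0r)
    [C *m B + _]addrC subrK.
have e2 : block_mx 1%:M B C 1%:M =
    block_mx (1%:M - B *m C) B 0 1%:M *m block_mx 1%:M 0 C 1%:M :>
      'M[A]_(m + n).
  by rewrite mulmx_block ?(mul1mx, mul0mx, mulmx0, mulmx1) ?(addr0, add0r)
    subrK.
have := e1; rewrite {1}e2 => /(congr1 determinant).
by rewrite !det_mulmx !det_ublock !det_lblock !det1 !mulr1 !mul1r.
Qed.

(** The matrix on the left is [(1 + U) (1 - L' Y)], and the first factor has determinant 1. This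
    passes from the points of the determinant to the [N] functions. *)
Lemma det_one_sub_dressed n N (lev : 'I_n -> nat) (U : 'M[A]_n)
    (L L' : 'M[A]_(n, N)) (Y : 'M[A]_(N, n)) :
  (forall u v, (lev u <= lev v)%N -> U u v = 0) -> (1%:M + U) *m L' = L ->
  \det (1%:M + U - L *m Y) = \det (1%:M - Y *m L').
Proof.
move=> U0 <-; rewrite -mulmxA -[X in X - _]mulmx1 -mulmxBr det_mulmx.
by rewrite (det_one_strict U0) mul1r det_one_subC.
Qed.

End FiniteDeterminants.

(** * Gated products of shift operators *)

Section Dressing.
Variables (A : comNzRingType) (b : nat -> A) (g : nat -> nat -> A).
Implicit Types (Phi Psi h : nat -> A).

Definition par m n : seq A := [seq b r | r <- index_iota m n].

Lemma size_par m n : size (par m n) = (n - m)%N.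
Proof. by rewrite size_map size_iota. Qed.

Lemma par_nil m n : (n <= m)%N -> par m n = [::].
Proof. by rewrite /par /index_iota -subn_eq0 => /eqP ->. Qed.

Lemma par_cons m n : (m < n)%N -> par m n = b m :: par m.+1 n.
Proof. by move=> mn; rewrite /par /index_iota -[(n - m)%N](subnSK mn). Qed.

Lemma par_rcons m n : (m <= n)%N -> par m n.+1 = rcons (par m n) (b n).
Proof.
move=> mn; rewrite /par /index_iota subSn // -addn1 iotaD map_cat cats1.
by rewrite subnKC.
Qed.

(* Levels are numbered from 0, and [ddag (b s.+1)] leads from level s.+1 to level
   s: this is g_m T_(m+1) g_(m+1) ... g_(n-1) T_n Psi, with T_s = [ddag (b s)]. *)
Definition gauged Psi m n : nat -> A :=
  foldr (fun s v k => g s k * ddag (b s.+1) v k) Psi (index_iota m n).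

Lemma gauged_step Psi m n : (m < n)%N ->
  gauged Psi m n = fun k => g m k * ddag (b m.+1) (gauged Psi m.+1 n) k.
Proof. by move=> mn; rewrite /gauged /index_iota -[(n - m)%N](subnSK mn). Qed.

Lemma gauged_nn Psi n : gauged Psi n n = Psi.
Proof. by rewrite /gauged /index_iota subnn. Qed.

(** Peels off the innermost step, next to [h], whereas [gauged_step] peels off the outermost one. *)
Lemma gauged_recr h t :
  gauged h 0 t.+1 = gauged (fun k => g t k * ddag (b t.+1) h k) 0 t.
Proof.
rewrite /gauged /index_iota !subn0.
have -> : iota 0 t.+1 = rcons (iota 0 t) t by rewrite -[t.+1]addn1 iotaD cats1.
by rewrite foldr_rcons.
Qed.

Lemma gaugedB h1 h2 t : gauged (fun k => h1 k - h2 k) 0 t =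
  fun k => gauged h1 0 t k - gauged h2 0 t k.
Proof.
elim: t h1 h2 => [|t IH] h1 h2; first by rewrite !gauged_nn.
rewrite !gauged_recr -IH; congr gauged.
by apply/funext => k; rewrite ddagB mulrBr.
Qed.

(* Phi g_0 T_1 g_1 ... g_(t-1) T_t: T_s acts from the right as [dop (b s)]. *)
Fixpoint dressed Phi t : nat -> A :=
  if t is s.+1 then dop (b t) (fun n => g s n * dressed Phi s n) else Phi.

(** At each level [s] write 1 as [g s + (1 - g s)]: the first part continues the dressed function,
    the second is carried to level [t] by bare shift operators. In matrix form this is the relation
    [(1 + U) L' = L] of [det_kernel]. *)
Lemma dops_dressed Phi t n :
  dops (par 1 t.+1) Phi n = dressed Phi t n +
  \sum_(s < t) dops (par s.+1 t.+1) (fun m => (1 - g s m) * dressed Phi s m) n.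
Proof.
elim: t n => [|t IH] n; first by rewrite par_nil // big_ord0 addr0.
rewrite par_rcons // dops_rcons {1}/dop !IH big_ord_recr /= mulrDr opprD.
rewrite par_cons // par_nil //= mulr_sumr.
have -> : \sum_(s < t) dops (par s.+1 t.+2)
  (fun m => (1 - g s m) * dressed Phi s m) n =
    \sum_(s < t) dops (par s.+1 t.+1) (fun m => (1 - g s m) * dressed Phi s m) n
      -
    \sum_(s < t) b t.+1 *
       dops (par s.+1 t.+1) (fun m => (1 - g s m) * dressed Phi s m) n.+1.
  rewrite -sumrB; apply: eq_bigr => s _.
  by rewrite par_rcons ?dops_rcons // ltnS ltnW.
by rewrite /dop; ring.
Qed.

Lemma ddags_supp (s : seq A) h c : (forall n, (c <= n)%N -> h n = 0) ->
  forall n, (c + size s <= n)%N -> ddags s h n = 0.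
Proof.
move=> h0; elim: s => [|a s IH] n /=; first by rewrite addn0; exact: h0.
by rewrite addnS => cn; exact: (ddag_supp a IH).
Qed.

Lemma dops_dop (s : seq A) a h : dops s (dop a h) = dop a (dops s h).
Proof. by rewrite -dops_rcons /dops foldr_rcons. Qed.

Lemma sum_dops (s : seq A) (f h : nat -> A) c M :
  (forall n, (c <= n)%N -> h n = 0) -> (c + size s <= M)%N ->
  \sum_(n < M) f n * ddags s h n = \sum_(n < M) dops s f n * h n.
Proof.
move=> h0; elim: s f => //= a s IH f; rewrite addnS => cM.
rewrite sum_by_parts0; first by rewrite IH ?dops_dop // ltnW.
move=> n Mn; apply: (ddags_supp h0).
by apply: leq_trans Mn; rewrite -ltnS (ltn_predK cM).
Qed.

(** One summation by parts per level. Each [ddag] extends the support of [h] by one, and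
    [c + t <= M] keeps it inside the range, so no boundary term arises. *)
Lemma sum_gauged Phi h c t M :
  (forall n, (c <= n)%N -> h n = 0) -> (c + t <= M)%N ->
  \sum_(n < M) Phi n * gauged h 0 t n = \sum_(n < M) dressed Phi t n * h n.
Proof.
elim: t h c => [|t IH] h c h0 cM; first by rewrite gauged_nn.
rewrite gauged_recr (IH _ c.+1).
- rewrite (eq_bigr (fun n : 'I_M => (g t n * dressed Phi t n) * ddag (b t.+1) h
    n)).
    rewrite (sum_by_parts0 (b t.+1) (fun n => g t n * dressed Phi t n)) //.
    move=> n Mn; apply: h0; apply: leq_trans Mn.
    by lia.
  by move=> n _; rewrite mulrCA mulrA.
- by move=> n cn; rewrite (ddag_supp _ h0) ?mulr0.
- by rewrite addSnnS.
Qed.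

(** The gates are switched on one level at a time. Each difference carries a factor [1 - g t], hence
    has finite support, and [sum_gauged] applies to it even if [Psi] has infinite support. *)
Lemma sum_gauged_sub Phi Psi N c M :
  (forall t n, (c <= n)%N -> g t n = 1) -> (c + N <= M)%N ->
  \sum_(n < M) Phi n * gauged Psi 0 N n =
  \sum_(n < M) Phi n * ddags (par 1 N.+1) Psi n -
  \sum_(t < N) \sum_(n < M)
     dressed Phi t n * ((1 - g t n) * ddags (par t.+1 N.+1) Psi n).
Proof.
move=> g1 cM; suff H t : (t <= N)%N ->
    \sum_(n < M) Phi n * gauged (ddags (par t.+1 N.+1) Psi) 0 t n =
    \sum_(n < M) Phi n * ddags (par 1 N.+1) Psi n -
    \sum_(s < t) \sum_(n < M)
      dressed Phi s n * ((1 - g s n) * ddags (par s.+1 N.+1) Psi n).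
  by have := H N (leqnn N); rewrite par_nil.
elim: t => [|t IH] tN; first by rewrite big_ord0 subr0.
rewrite big_ord_recr opprD addrA /= -IH ?(ltnW tN) // gauged_recr.
rewrite -(@sum_gauged Phi (fun k => (1 - g t k) * ddags (par t.+1 N.+1) Psi k) c
  t M); last 2 first.
- by move=> n cn; rewrite g1 // subrr mul0r.
- by apply: leq_trans cM; rewrite leq_add2l ltnW.
rewrite -sumrB; apply: eq_bigr => n _; rewrite -mulrBr; congr (_ * _).
have := gaugedB (ddags (par t.+1 N.+1) Psi)
  (fun k => (1 - g t k) * ddags (par t.+1 N.+1) Psi k) t.
move=> /(congr1 (fun f => f (nat_of_ord n))) /= <-; congr (gauged _ _ _ _).
apply/funext => k; rewrite mulrBl mul1r opprB addrC subrK.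
by rewrite (@par_cons t.+1).
Qed.

End Dressing.

Section LevelDeterminants.
Variables (A : comNzRingType) (N M : nat).
Local Notation conf := {ffun 'I_N -> 'I_M.+1}.
Implicit Types (x : conf) (f : 'I_N -> nat -> nat -> A).

(* Because of [minn j t] the columns [j >= t] evaluate the same functions, so that
   the determinant is alternating in the coordinates [x j] with [j >= t]. *)
Definition frozen_det f t x := \det (\matrix_(i, j) f i (minn j t) (x j)).

Lemma frozen_det_swap f (t p q : 'I_N) x : (t <= p)%N -> (t <= q)%N ->
  frozen_det f t (swapc p q x) = (-1) ^+ (p != q) * frozen_det f t x.
Proof.
move=> tp tq; rewrite /frozen_det.
have -> : \matrix_(i, j) f i (minn j t) (swapc p q x j) =
    col_perm (tperm p q) (\matrix_(i, j) f i (minn j t) (x j)).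
  apply/matrixP => i j; rewrite !mxE ffunE; congr (f _ _ _).
  by case: tpermP => // ->; rewrite !(minn_idPr _).
by rewrite col_permE det_mulmx det_perm odd_permV odd_tperm mulrC.
Qed.

Lemma frozen_det_eq0 f (t p q : 'I_N) x : (t <= p)%N -> (t <= q)%N ->
  p != q -> x p = x q -> frozen_det f t x = 0.
Proof.
move=> tp tq pq xpq; apply: (det_eq_col pq) => i.
by rewrite !mxE xpq !(minn_idPr _).
Qed.

Lemma eq_det_mul (f1 f2 h1 h2 : 'I_N -> 'I_N -> A) :
  (forall i j, f1 i j = f2 i j) -> (forall i j, h1 i j = h2 i j) ->
  \det (\matrix_(i, j) f1 i j) * \det (\matrix_(i, j) h1 i j) =
  \det (\matrix_(i, j) f2 i j) * \det (\matrix_(i, j) h2 i j).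
Proof.
by move=> Hf Hh; do 2!f_equal; apply/matrixP => i j; rewrite !mxE.
Qed.

End LevelDeterminants.

(** * The passage from one level to the next *)

Section Stages.
Variables (A : comNzRingType) (N M : nat) (b : nat -> A) (g : nat -> nat -> A).
Variables (Phi Psi : 'I_N -> nat -> A).

Local Notation conf := {ffun 'I_N -> 'I_M.+1}.
Local Notation V j t := (gauged b g (Psi j) t N).
Implicit Types x : conf.

Definition left_col i j n := dops (par b 1 j.+1) (Phi i) n.
(** For [t < N] this is [right_col] with the factor [g t] of [V i t] removed. *)
Definition ungated_col t i j n := ddags (par b j.+1 t.+1)
  (ddag (b t.+1) (V i t.+1)) n.
Definition right_col t i j n := ddags (par b j.+1 t.+1) (V i t) n.

Lemma stage_max (t : 'I_N) (E : pred conf) :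
  (forall (p q : 'I_N) x, (t <= p)%N -> (t <= q)%N -> E (swapc p q x) = E x) ->
  \sum_(x | desc t x && E x) frozen_det left_col t x * frozen_det (right_col t)
    t x = (N - t)%:R *
  \sum_(x | desc t.+1 x && E x) frozen_det left_col t x * frozen_det
    (right_col t) t x.
Proof.
move=> HE; apply: sum_desc_max => // [p q x tp tq|p q x tp tq pq xpq].
  by rewrite !frozen_det_swap // mulrACA -expr2 sqrr_sign mul1r.
by rewrite (frozen_det_eq0 _ tp tq pq xpq) mul0r.
Qed.

Lemma move_columns (t : 'I_N) (E : pred conf) :
  (forall (q : 'I_N) v x, (t < q)%N -> E (updc q v x) = E x) ->
  \sum_(x | desc t.+1 x && E x) frozen_det left_col t x *
    frozen_det (ungated_col t) t x =
  \sum_(x | desc t.+1 x && E x)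
    frozen_det left_col t.+1 x * frozen_det (right_col t.+1) t.+1 x.
Proof.
move=> HE.
(* [pst r] and [qst r] are the columns after the operator with parameter [b t.+1] has changed sides
   in the columns [t < j < r]. Thus [T t.+1] and [T N] are the two sides of the claim. *)
pose pst r (l j : 'I_N) : nat -> A := if (j <= t)%N then left_col l j
  else if (j < r)%N then left_col l t.+1 else left_col l t.
pose qst r (l j : 'I_N) : nat -> A := if (j <= t)%N then right_col t.+1 l j
  else if (j < r)%N then V l t.+1 else ddag (b t.+1) (V l t.+1).
pose T r := \sum_(x | desc t.+1 x && E x)
  \det (\matrix_(l, j) pst r l j (x j)) * \det (\matrix_(l, j) qst r l j (x j)).
transitivity (T t.+1).
  apply: eq_bigr => x _; rewrite /frozen_det; apply: eq_det_mul => l j;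
    rewrite ?mxE /pst /qst ?/ungated_col.
    by have [//|tj] := leqP j t; rewrite ltnS leqNgt tj.
  have [jt|tj] := leqP j t.
    by rewrite /right_col [par _ _ t.+2]par_rcons // /ddags foldr_rcons.
  by rewrite ltnS leqNgt tj /= par_nil.
transitivity (T N).
  have H r : (r <= N)%N -> (t < r)%N -> T t.+1 = T r.
    elim: r => [|r IH] rN; first by rewrite ltn0.
    rewrite ltnS leq_eqVlt => /orP[/eqP <-|tr]; first by [].
    rewrite (IH (ltnW rN) tr).
    have := @move_column A N M t (Ordinal rN) E (b t.+1) (pst r)
      (qst r) (fun l => V l t.+1) tr.
    set S1 := (X in _ -> _ -> X = _); set S2 := (X in _ -> _ -> _ = X).
    have rt : (r <= t)%N = false by rewrite leqNgt tr.
    have jrE (j : 'I_N) : j != Ordinal rN -> (j < r.+1)%N = (j < r)%N.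
      by rewrite -val_eqE /= => jr; rewrite ltnS leq_eqVlt (negPf jr).
    suff [-> ->] : T r = S1 /\ T r.+1 = S2.
      apply.
        by move=> x v; exact: HE.
      by move=> l; rewrite /pst /= rt ltnn leqnn.
    split; apply: eq_bigr => x _; apply: eq_det_mul => l j;
      rewrite ?mxE /pst /qst; have [->|jr] := eqVneq j (Ordinal rN) => //=;
      rewrite ?rt ?ltnSn ?ltnn //; rewrite ?jrE //.
    by rewrite /left_col [in LHS]par_rcons // dops_rcons.
  by apply: H.
apply: eq_bigr => x _; rewrite /frozen_det; apply: eq_det_mul => l j;
  rewrite ?mxE /pst /qst ltn_ord.
  by have [jt|tj] := leqP j t; [rewrite (minn_idPl _) // ltnW|rewrite
    (minn_idPr _)].
have [jt|tj] := leqP j t; [by rewrite (minn_idPl _) // ltnW|].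
by rewrite (minn_idPr _) // /right_col par_nil.
Qed.

Lemma desc_gap t (x : conf) (p q : 'I_N) : desc t x -> (p <= q <= t)%N ->
  (x q + (q - p) <= x p)%N.
Proof.
move=> /descP dx /andP[pq qt]; have [d] : exists d, (q = p + d :> nat)%N.
  by exists (q - p)%N; rewrite subnKC.
elim: d q {pq} qt => [|d IH] q qt qE.
  have -> : q = p by apply: val_inj; rewrite /= qE addn0.
  by rewrite subnn addn0.
have qN : (p + d < N)%N by have := ltn_ord q; lia.
have := IH (Ordinal qN); rewrite /= addKn => IHq.
have /= xq : (x q < x (Ordinal qN))%N by apply: dx; rewrite /=; lia.
by have /= := IHq ltac:(lia) erefl; lia.
Qed.

(** Column [j < t] carries [t - j] factors [ddag], and strict decrease gives [x j >= x t + (t - j)],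
    which is the gap that [det_gauge] asks for. *)
Lemma right_col_gauge (t : 'I_N) (x : conf) :
  desc t.+1 x -> (forall v, (x t < v)%N -> g t v = 1) ->
  frozen_det (right_col t) t x = (\prod_(j : 'I_N | (t <= j)%N) g t (x j)) *
    frozen_det (ungated_col t) t x.
Proof.
move=> dx g1.
have dtx : desc t x by apply/descP => p q pt; move/descP: dx; apply;
  exact: ltnW.
rewrite /frozen_det -(@det_gauge _ _ t (fun j => x j) (g t)
  (fun l => ddag (b t.+1) (V l t.+1)) (fun j => par b (minn j t).+1 t.+1)) //.
- congr (\det _); apply/matrixP => l j; rewrite !mxE /right_col gauged_step //.
- move=> j jt; rewrite size_par (minn_idPl (ltnW jt)) subSS.
  by apply: (desc_gap dtx); rewrite (ltnW jt) leqnn.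
- by move=> j tj; rewrite (minn_idPr tj) par_nil.
Qed.

(** Serves the case in which [g t] differs from 1 above [x t]: the gates come out of the columns
    [j >= t] alone, and the other factor is left unspecified. *)
Lemma right_col_factor (t : 'I_N) (x : conf) : exists f,
  frozen_det (right_col t) t x = (\prod_(j : 'I_N | (t <= j)%N) g t (x j)) * f.
Proof.
pose D : 'M[A]_N := \matrix_(l, j) (if (t <= j)%N
  then ddag (b t.+1) (V l t.+1) (x j) else right_col t l j (x j)).
exists (\det D); rewrite big_mkcond /=.
have -> : \prod_(j : 'I_N) (if (t <= j)%N then g t (x j) else 1) =
    \det (diag_mx (\row_j if (t <= j)%N then g t (x j) else 1)).
  by rewrite det_diag; apply: eq_bigr => j _; rewrite mxE.
rewrite mulrC -det_mulmx; congr (\det _); apply/matrixP => l j.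
rewrite mul_mx_diag !mxE; have [tj|jt] := leqP t j; last first.
  by rewrite mulr1.
by rewrite /right_col par_nil //= gauged_step // mulrC.
Qed.

Lemma card_gt (t : 'I_N) : (\sum_(j : 'I_N | (t <= j)%N && (j != t)) 1 =
  N - t.+1)%N.
Proof. by rewrite subnS -card_geq [in RHS](bigD1 t). Qed.

End Stages.

(** * Extraction of coefficients *)

Section FreeVariables.
Variables (K : comNzRingType) (n : nat).
Implicit Types (f : mpoly n K) (m e : multinom n) (j : 'I_n).

Definition var_free j f := forall m, m j != 0%N -> mcoeff m f = 0.

Lemma var_freeC j c : var_free j (mpolyC n c).
Proof.
move=> m mj; rewrite mcoeffC; case: eqP => [m0|]; last by rewrite mulr0.
by rewrite m0 mnm0E eqxx in mj.
Qed.

Lemma var_freeB j f1 f2 : var_free j f1 -> var_free j f2 ->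
  var_free j (f1 - f2).
Proof. by move=> H1 H2 m mj; rewrite mcoeffB H1 // H2 // subr0. Qed.

Lemma mcoeffM_eq0 m f1 f2 :
  (forall k1 k2, m = mnm_add k1 k2 -> mcoeff k1 f1 * mcoeff k2 f2 = 0) ->
  mcoeff m (f1 * f2) = 0.
Proof. by move=> H; rewrite mcoeffM big1 // => -[k1 k2] /eqP /= /H. Qed.

Lemma var_freeM j f1 f2 : var_free j f1 -> var_free j f2 ->
  var_free j (f1 * f2).
Proof.
move=> H1 H2 m mj; apply: mcoeffM_eq0 => k1 k2 mE.
move: mj; rewrite mE mnmDE; have [k1j|/H1 ->] := eqVneq (k1 j) 0%N;
  last by rewrite mul0r.
by rewrite k1j => /H2 ->; rewrite mulr0.
Qed.

Lemma var_free_sum j (I : Type) (r : seq I) (Q : pred I) (F : I -> mpoly n K) :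
  (forall x, Q x -> var_free j (F x)) -> var_free j (\sum_(x <- r | Q x) F x).
Proof. by move=> H m mj; rewrite raddf_sum big1 // => x Qx; exact: H. Qed.

Lemma var_free_prod j (I : Type) (r : seq I) (Q : pred I) (F : I -> mpoly n K) :
  (forall x, Q x -> var_free j (F x)) -> var_free j (\prod_(x <- r | Q x) F x).
Proof.
move=> H; elim/big_rec: _ => [|x f Qx Hf]; first by rewrite -mpolyC1;
  exact: var_freeC.
by apply: var_freeM => //; exact: H.
Qed.

Lemma var_free_det j N (B : 'M[mpoly n K]_N) :
  (forall u v, var_free j (B u v)) -> var_free j (\det B).
Proof.
move=> H; apply: var_free_sum => s _; apply: var_freeM;
  last exact: var_free_prod.
by case: odd_perm; rewrite ?expr0 ?expr1 -mpolyC1 -?mpolyCN; exact: var_freeC.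
Qed.

Lemma var_freeX j l : l != j -> var_free j (mpolyX K (mnm1 l)).
Proof.
move=> lj m mj; rewrite mcoeffX; case: eqP => // ml.
by rewrite -ml mnm1E (negPf lj) in mj.
Qed.

Lemma var_free_ddag j b (h : nat -> mpoly n K) :
  var_free j b -> (forall l, var_free j (h l)) ->
    forall l, var_free j (ddag b h l).
Proof.
move=> fb fh l; apply: var_freeB => //; apply: var_freeM;
  first exact: var_freeM.
by rewrite -mpolyC_nat; exact: var_freeC.
Qed.

Lemma var_free_dop j b (h : nat -> mpoly n K) :
  var_free j b -> (forall l, var_free j (h l)) ->
    forall l, var_free j (dop b h l).
Proof. by move=> fb fh l; apply: var_freeB => //; apply: var_freeM. Qed.

Lemma mcoeff_monoM_gt e m j f : (m j < e j)%N -> mcoeff m (mpolyX K e * f) = 0.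
Proof.
move=> me; apply: mcoeffM_eq0 => k1 k2 mE.
rewrite mcoeffX; case: eqP => [ek|_]; last by rewrite mul0r.
by move: me; rewrite mE ek mnmDE ltnNge leq_addr.
Qed.

Lemma mcoeff_monoM_free e m j f :
  var_free j f -> e j != m j -> mcoeff m (mpolyX K e * f) = 0.
Proof.
move=> ff me; apply: mcoeffM_eq0 => k1 k2 mE.
rewrite mcoeffX; case: eqP => [ek|_]; last by rewrite mul0r.
rewrite ff ?mulr0 //; apply: contraNneq me => k20.
by rewrite mE ek mnmDE k20 addn0.
Qed.

Lemma mcoeff_monoM_sum e m (I : Type) (r : seq I) (Q : pred I)
  (F : I -> mpoly n K) :
  mcoeff m (mpolyX K e * \sum_(x <- r | Q x) F x) =
  \sum_(x <- r | Q x) mcoeff m (mpolyX K e * F x).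
Proof. by rewrite mulr_sumr raddf_sum. Qed.

(** The extraction at one level: [jl] and [jr] index the variables z and w of that level, and [S] is
    the exponent of the product of its gates. For [x < a] the monomial contains z too often; for
    [a < x] one of the two exponents is wrong and [L * Q], free of both variables, cannot repair
    it. *)
Lemma mcoeff_pinned (m e e' S : multinom n) (jl jr : 'I_n) (L R Q : mpoly n K)
    (x a : nat) :
  var_free jl (L * Q) -> var_free jr (L * Q) ->
  (exists f, R = mpolyX K S * f) -> ((a <= x)%N -> R = mpolyX K S * Q) ->
  ((x < a)%N -> (m jl < S jl)%N) ->
  ((a < x)%N -> mnm_add e S jl != m jl \/ mnm_add e S jr != m jr) ->
  (x = a -> e' = mnm_add e S) ->
  mcoeff m (mpolyX K e * (L * R)) =
  if x == a then mcoeff m (mpolyX K e' * (L * Q)) else 0.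
Proof.
move=> fl fr [f Rf] RQ lt gt eq; have [xa|xa|xa] := ltngtP x a.
- rewrite Rf (mulrCA L) (mulrCA (mpolyX K e)); apply: (@mcoeff_monoM_gt _ _ jl).
  exact: (lt xa).
- rewrite RQ ?(ltnW xa) // (mulrCA L) (mulrA (mpolyX K e)) -mpolyXD.
  by case: (gt xa); apply: mcoeff_monoM_free.
- by rewrite RQ ?xa // eq // (mulrCA L) (mulrA (mpolyX K e)) -mpolyXD.
Qed.

Lemma mcoeff_monoM_nat e m c f :
  mcoeff m (mpolyX K e * (c%:R * f)) = c%:R * mcoeff m (mpolyX K e * f).
Proof. by rewrite mulrCA -mpolyC_nat mcoeffCM. Qed.

Lemma mcoeff_mono0M m f : mcoeff m (mpolyX K mnm0 * f) = mcoeff m f.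
Proof. by rewrite mpolyX0 mul1r. Qed.

Lemma mcoeff_monoMC m c : mcoeff m (mpolyX K m * mpolyC n c) = c.
Proof. by rewrite mulrC mcoeffCM mcoeffX eqxx mulr1. Qed.

Lemma mpolyC_sum_det N (I : finType) (Q : pred I) (F H : I -> 'M[K]_N) :
  mpolyC n (\sum_(x | Q x) \det (F x) * \det (H x)) =
  \sum_(x | Q x) \det (\matrix_(u, v) mpolyC n (F x u v)) *
    \det (\matrix_(u, v) mpolyC n (H x u v)).
Proof.
rewrite raddf_sum; apply: eq_bigr => x _ /=.
have C_det (B : 'M[K]_N) :
    mpolyC n (\det B) = \det (\matrix_(u, v) mpolyC n (B u v)).
  rewrite -(det_map_mx (mpolyC n (R := K))).
  by congr (\det _); apply/matrixP => u v; rewrite !mxE.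
by rewrite mpolyCM !C_det.
Qed.

End FreeVariables.

(** * Extraction of the coefficient, level by level *)

Section CoefficientExtraction.
Variables (K : comNzRingType) (k N M : nat).
Variables (i : 'I_k -> 'I_N) (a : 'I_k -> nat).
Hypothesis i_inj : injective i.
Variables (Phi Psi : 'I_N -> nat -> K) (b : nat -> K).

Local Notation P := (mpoly (k + k) K).
Local Notation conf := {ffun 'I_N -> 'I_M.+1}.
Local Notation C := (@mpolyC (k + k) K).
Local Notation zX p := (mpolyX K (mnm1 (lshift k p)) : P).
Local Notation wX p := (mpolyX K (mnm1 (rshift k p)) : P).

(** Written so that [1 - gate] is the sum over [p] multiplying a column of the kernel in the
    determinant. For injective [i] at most one [p] contributes, and the value is z_p, w_p or 1. *)
Definition gate (s n : nat) : P :=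
  1 - \sum_(p < k) ((1 - zX p) * ((i p == s :> nat) && (n < a p)%N)%:R +
                    (1 - wX p) * ((i p == s :> nat) && (n == a p))%:R).

Lemma gate_at p n :
  gate (i p) n = if (n < a p)%N then zX p else if n == a p then wX p else 1.
Proof.
rewrite /gate (bigD1 p) //= eqxx big1 => [|q qp].
  by case: ltngtP; rewrite /= ?mulr0 ?mulr1 ?addr0 ?add0r ?subr0 // subKr.
by rewrite val_eqE (inj_eq i_inj) (negPf qp) !mulr0 addr0.
Qed.

Lemma gate_off s n : (forall p, i p != s :> nat) -> gate s n = 1.
Proof.
move=> H; rewrite /gate big1 ?subr0 // => p _.
by rewrite (negPf (H p)) !mulr0 addr0.
Qed.

Lemma gate_far s n : (forall p, (a p < n)%N) -> gate s n = 1.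
Proof.
move=> H; rewrite /gate big1 ?subr0 // => p _.
by rewrite ltnNge (ltnW (H p)) (gtn_eqF (H p)) !andbF !mulr0 addr0.
Qed.

Lemma var_free_gate (q : 'I_(k + k)) s n :
  (forall p, i p = s :> nat -> lshift k p != q /\ rshift k p != q) ->
  var_free q (gate s n).
Proof.
move=> H; have free1 : var_free q (1 : P) by rewrite -mpolyC1; exact: var_freeC.
have free0 : var_free q (0 : P) by rewrite -mpolyC0; exact: var_freeC.
apply: var_freeB => //; apply: var_free_sum => p _.
have [/H[zq wq]|_] := eqVneq (i p : nat) s; last by rewrite !mulr0 addr0.
have freen (c : bool) : var_free q (c%:R : P) by case: c.
rewrite -[X in X + _]opprK addrC -[X in var_free _ X]opprK -sub0r.
apply: var_freeB => //; rewrite opprB.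
apply: var_freeB; last apply: var_freeM => //.
  by rewrite -sub0r; apply: var_freeB => //; apply: var_freeM => //;
    apply: var_freeB => //; exact: var_freeX.
by apply: var_freeB => //; exact: var_freeX.
Qed.

Local Notation bC := (fun s => C (b s)).
Local Notation PhiC := (fun j n => C (Phi j n)).
Local Notation V j t := (gauged bC gate (fun n => C (Psi j n)) t N).

Definition pinned t (x : conf) :=
  [forall p : 'I_k, (i p < t)%N ==> (x (i p) == a p :> nat)].

(** The part of the target monomial collected from the levels below [t]: trivial for [t = 0], equal
    to [m] for [t = N]. *)
Definition prefix t : multinom (k + k) :=
  Multinom [tuple match fintype.split q with
                  | inl p => if (i p < t)%N then (N - (i p).+1)%N else 0%N
                  | inr p => ((i p < t)%N : nat)
                  end | q < k + k].

Lemma prefixl t p : prefix t (lshift k p) =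
  if (i p < t)%N then (N - (i p).+1)%N else 0%N.
Proof. by rewrite multinomE tnth_mktuple -[lshift k p]/(unsplit (inl p))
  unsplitK. Qed.

Lemma prefixr t p : prefix t (rshift k p) = (i p < t)%N :> nat.
Proof. by rewrite multinomE tnth_mktuple -[rshift k p]/(unsplit (inr p))
  unsplitK. Qed.

Local Notation lcol := (left_col bC PhiC).
Local Notation rcol := (right_col bC gate (fun j n => C (Psi j n))).
Local Notation ucol := (ungated_col bC gate (fun j n => C (Psi j n))).

(* The levels below [t] have been treated: the coordinates [x j], [j < t], are
   frozen, and those with [j >= t] are unordered. *)
Definition stage t := \sum_(x | desc t x && pinned t x)
  frozen_det lcol t x * frozen_det (rcol t) t x.

Lemma var_free_dops q (s : seq P) h : (forall c, c \in s -> var_free q c) ->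
  (forall n, var_free q (h n)) -> forall n, var_free q (dops s h n).
Proof.
elim: s => // c s IH cs fh; apply: var_free_dop; first by apply: cs;
  rewrite mem_head.
by apply: IH => // d ds; apply: cs; rewrite inE ds orbT.
Qed.

Lemma var_free_ddags q (s : seq P) h : (forall c, c \in s -> var_free q c) ->
  (forall n, var_free q (h n)) -> forall n, var_free q (ddags s h n).
Proof.
elim: s => // c s IH cs fh; apply: var_free_ddag; first by apply: cs;
  rewrite mem_head.
by apply: IH => // d ds; apply: cs; rewrite inE ds orbT.
Qed.

Lemma var_free_par q l r c : c \in par bC l r -> var_free q c.
Proof. by move=> /mapP[s _ ->]; exact: var_freeC. Qed.

Lemma var_free_gauged q l t : (forall s n, (t <= s)%N -> var_free q (gate s n))
  ->
  forall n, var_free q (V l t n).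
Proof.
move=> H; rewrite /gauged.
have {}H s n : s \in index_iota t N -> var_free q (gate s n).
  by rewrite mem_index_iota => /andP[/H].
elim: index_iota H => [|s r IH] H n /=; first exact: var_freeC.
apply: var_freeM; first by apply: H; rewrite mem_head.
apply: var_free_ddag; first exact: var_freeC.
by apply: IH => s' n' s'r; apply: H; rewrite inE s'r orbT.
Qed.

Variable m : multinom (k + k).
Hypothesis ml : forall p, m (lshift k p) = (N - (i p).+1)%N.
Hypothesis mr : forall p, m (rshift k p) = 1%N.

(** If [t] is some [i p], every gate at level [t] is a monomial, and so is their product over the
    [N - t] free columns. The required exponents are met only if [x t = a p], with w_p from column
    [t] and z_p from each later column. *)
Lemma stage_pin (t : 'I_N) :
  mcoeff m (mpolyX K (prefix t) *
    \sum_(x | desc t.+1 x && pinned t x) frozen_det lcol t x * frozen_det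
      (rcol t) t x) =
  mcoeff m (mpolyX K (prefix t.+1) *
    \sum_(x | desc t.+1 x && pinned t.+1 x) frozen_det lcol t x *
      frozen_det (ucol t) t x).
Proof.
(* At a level that is not observed all gates are 1, and neither the prefix nor the pinning condition
   changes. *)
have [/existsP[p /eqP itp]|] := boolP [exists p, i p == t]; last first.
  rewrite negb_exists => /forallP nt.
  have ltE p : (i p < t.+1)%N = (i p < t)%N.
    by rewrite ltnS leq_eqVlt val_eqE (negPf (nt p)).
  have -> : prefix t.+1 = prefix t.
    by apply/mnmP => q; rewrite !multinomE !tnth_mktuple;
      case: fintype.split => r;
      rewrite ltE.
  rewrite [LHS]mcoeff_monoM_sum [RHS]mcoeff_monoM_sum; apply: eq_big => x.
    by congr (_ && _); apply: eq_forallb => p; rewrite ltE.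
  case/andP=> dx _; rewrite right_col_gauge;
    [|exact: dx|by move=> v _; exact: gate_off].
  rewrite big1 ?mul1r; first by [].
  by move=> j _; exact: gate_off.
have pinE x : pinned t.+1 x = pinned t x && (x (i p) == a p :> nat).
  apply/forallP/andP => [H|[/forallP H xp] q].
    split; last by have /implyP := H p; apply; rewrite itp.
    by apply/forallP => q; apply/implyP => /ltnW qt; have /implyP := H q; apply.
  apply/implyP; rewrite ltnS leq_eqVlt => /orP[|qt]; last by have /implyP :=
    H q; apply.
  by rewrite val_eqE -itp (inj_eq i_inj) => /eqP ->.
pose mon n : multinom (k + k) :=
  if (n < a p)%N then mnm1 (lshift k p)
  else if n == a p then mnm1 (rshift k p) else mnm0.
have gateE n : gate t n = mpolyX K (mon n).
  by rewrite -itp gate_at /mon; do 2!case: ifP => // _; rewrite mpolyX0.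
have prodE (x : conf) : \prod_(j : 'I_N | (t <= j)%N) gate t (x j) =
    mpolyX K (\big[mnm_add/mnm0]_(j : 'I_N | (t <= j)%N) mon (x j)).
  by rewrite -mprodXE; apply: eq_bigr => j _; exact: gateE.
have monE n q : mon n q = ((n < a p)%N * (lshift k p == q) + (n == a p) *
  (rshift k p == q))%N.
  by rewrite /mon; case: ltngtP => _;
    rewrite ?mnm1E ?mnm0E ?mul1n ?mul0n ?addn0.
have preL : prefix t (lshift k p) = 0%N by rewrite prefixl itp ltnn.
have preR : prefix t (rshift k p) = 0%N by rewrite prefixr itp ltnn.
have freeL q (x : conf) : var_free q (frozen_det lcol t x).
  apply: var_free_det => u v; rewrite mxE; apply: var_free_dops.
    by move=> c; exact: var_free_par.
  by move=> n; exact: var_freeC.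
(* The gates left in [ucol t] belong to levels above [t], hence involve neither z_p nor w_p. *)
have freeR (q : 'I_(k + k)) (x : conf) :
    (forall p', p' != p -> lshift k p' != q /\ rshift k p' != q) ->
    var_free q (frozen_det (ucol t) t x).
  move=> Hq; apply: var_free_det => u v; rewrite mxE; apply: var_free_ddags.
    by move=> c; exact: var_free_par.
  apply: var_free_ddag; first exact: var_freeC.
  apply: var_free_gauged => s n ts; apply: var_free_gate => p' ip's.
  by apply: Hq; apply: contraTneq ts => p'p; rewrite -ip's p'p itp ltnn.
have frL (x : conf) : var_free (lshift k p) (frozen_det lcol t x * frozen_det
    (ucol t) t x).
  apply: var_freeM => //; apply: freeR => p' p'p.
  by rewrite eq_lshift eq_rlshift.
have frR (x : conf) : var_free (rshift k p) (frozen_det lcol t x * frozen_det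
    (ucol t) t x).
  apply: var_freeM => //; apply: freeR => p' p'p.
  by rewrite eq_lrshift eq_rshift.
have lr q : (lshift k p == rshift k q) = false by rewrite eq_lrshift.
have rl q : (rshift k p == lshift k q) = false by rewrite eq_rlshift.
rewrite [LHS]mcoeff_monoM_sum [RHS]mcoeff_monoM_sum [LHS]big_mkcond
  [RHS]big_mkcond; apply: eq_bigr => x _.
rewrite pinE andbA; case: (boolP (desc _ _ && pinned t x)) => [/andP[dx _]|_];
  last first.
  by [].
set S := \big[mnm_add/mnm0]_(j : 'I_N | (t <= j)%N) mon (x j).
have SE q : S q = (\sum_(j : 'I_N | (t <= j)%N)
    ((x j < a p) * (lshift k p == q) + (x j == a p :> nat) *
      (rshift k p == q)))%N.
  by rewrite /S mnm_sumE; apply: eq_bigr => j _; exact: monE.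
rewrite andTb itp.
apply: (@mcoeff_pinned K _ m _ _ S (lshift k p) (rshift k p)).
- exact: frL.
- exact: frR.
- have [f Rf] := right_col_factor bC gate (fun j n => C (Psi j n)) t x.
  by exists f; rewrite Rf prodE.
- move=> ax; rewrite right_col_gauge; [by rewrite prodE|exact: dx|].
  move=> v xv; rewrite gateE /mon ltnNge (ltnW (leq_ltn_trans ax xv)).
  by rewrite (gtn_eqF (leq_ltn_trans ax xv)) mpolyX0.
(* All [N - t] free coordinates lie below [a p]: the exponent of z_p is one more than in [m]. *)
- move=> xa; rewrite ml SE itp (eq_bigr (fun=> 1%N)).
    by rewrite card_geq; have := ltn_ord t; lia.
  move=> j tj; rewrite eqxx rl muln0 addn0 muln1.
  suff -> : (x j < a p)%N by [].
  apply: leq_ltn_trans xa; move: tj; rewrite leq_eqVlt =>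
    /orP[/eqP/val_inj -> //|tj].
  by apply: ltnW; move/descP: dx; apply.
(* Column [t] contributes 1, so the exponents of z_p and w_p add up to at most [N - t.+1], one less
   than in [m]. *)
- move=> xa; rewrite !mnmDE preL preR ml mr itp.
  suff : (S (lshift k p) + S (rshift k p) <= N - t.+1)%N.
    have [-> ?|] := eqVneq (S (lshift k p)) (N - t.+1)%N; last by left.
    by right; lia.
  rewrite !SE -big_split /= -card_gt (bigD1 t) //=.
  rewrite ltnNge (ltnW xa) (gtn_eqF xa) !mul0n add0n; apply: leq_sum => j _.
  by rewrite !eqxx lr rl !muln0 !muln1 addn0 add0n; case: ltngtP.
- move=> xa.
  have {}SE q : S q = ((lshift k p == q) * (N - t.+1) + (rshift k p == q))%N.
    rewrite SE (bigD1 t) //= xa ltnn eqxx mul0n mul1n add0n addnC.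
    congr (_ + _)%N; rewrite -card_gt big_distrr;
      apply: eq_bigr => j /andP[tj jt].
    have xja : (x j < a p)%N.
      rewrite -xa; move/descP: dx; apply=> //.
      by rewrite ltn_neqAle tj andbT eq_sym val_eqE.
    by rewrite xja (ltn_eqF xja) mul0n addn0 mul1n; case: (_ == _).
  apply/mnmP => q; rewrite mnmDE SE -(splitK q).
  have tE p' : (p' != p) -> (i p' < t.+1)%N = (i p' < t)%N.
    by move=> p'p; rewrite ltnS leq_eqVlt val_eqE -itp (inj_eq i_inj)
      (negPf p'p).
  case: (fintype.split q) => p' /=.
    rewrite eq_lshift rl addn0 !prefixl; have [->|p'p] := eqVneq p' p.
      by rewrite itp ltnSn ltnn ?eqxx mul1n.
    by rewrite ?[p == _]eq_sym ?(negPf p'p) tE // ?mul0n ?addn0.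
  rewrite lr mul0n add0n eq_rshift !prefixr; have [->|p'p] := eqVneq p' p.
    by rewrite itp ltnSn ltnn ?eqxx.
  rewrite ?[p == _]eq_sym ?(negPf p'p) ?tE ?addn0 //.
Qed.

(** Select the largest free coordinate, pin it, then move the next shift operator: [stage_max],
    [stage_pin] and [move_columns] in this order. *)
Lemma stage_step (t : 'I_N) : mcoeff m (mpolyX K (prefix t) * stage t) =
  (N - t)%:R * mcoeff m (mpolyX K (prefix t.+1) * stage t.+1).
Proof.
have sw (p q : 'I_N) (x : conf) : (t <= p)%N -> (t <= q)%N ->
    pinned t (swapc p q x) = pinned t x.
  move=> tp tq; apply: eq_forallb => l; apply: implyb_id2l => lt.
  by rewrite ffunE tpermD //; apply: contraTneq lt => <-; rewrite -leqNgt.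
have up (q : 'I_N) v (x : conf) : (t < q)%N ->
    pinned t.+1 (updc q v x) = pinned t.+1 x.
  move=> tq; apply: eq_forallb => p; apply: implyb_id2l => pt.
  by rewrite ffunE ifN //; apply: contraTneq pt => ->; rewrite ltnS -ltnNge.
have -> : stage t = _ := stage_max bC gate PhiC (fun j n => C (Psi j n)) sw.
have -> : stage t.+1 = _ := esym (move_columns bC gate PhiC
  (fun j n => C (Psi j n)) up).
rewrite [LHS]mcoeff_monoM_nat.
exact: (congr1 (fun y => (N - t)%:R * y) (stage_pin t)).
Qed.

Lemma dops_mpolyC (s : seq K) h n :
  dops (map C s) (fun l => C (h l)) n = C (dops s h n).
Proof. by elim: s n => //= c s IH n; rewrite /dop !IH mpolyCB mpolyCM. Qed.

Lemma ddags_mpolyC (s : seq K) h n :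
  ddags (map C s) (fun l => C (h l)) n = C (ddags s h n).
Proof.
by elim: s n => //= c s IH n; rewrite /ddag !IH mpolyCB !mpolyCM mpolyC_nat.
Qed.

(** On the left [N!] comes from Andreief's identity, on the right from the product of the factors
    [N - t] of all stages. It can be cancelled only over a field of characteristic 0, as in
    [sum_pinned]. *)
Lemma mcoeff_det_gauged :
  N`!%:R * mcoeff m (\det (\matrix_(l, j) \sum_(v < M.+1) C (Phi l v) * V j 0
    v)) =
  N`!%:R * \sum_(x | desc N x && pinned N x)
    \det (\matrix_(l, j) dops (par b 1 j.+1) (Phi l) (x j)) *
    \det (\matrix_(l, j) ddags (par b j.+1 N.+1) (Psi l) (x j)).
Proof.
have parC l r : par bC l r = map C (par b l r) by rewrite /par -map_comp.
have step t : (t <= N)%N -> mcoeff m (mpolyX K (prefix 0) * stage 0) =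
    (N ^_ t)%:R * mcoeff m (mpolyX K (prefix t) * stage t).
  elim: t => [|t IH] tN; first by rewrite ffactn0 [RHS]mul1r.
  apply: (etrans (IH (ltnW tN))); rewrite ffactnSr natrM -[RHS]mulrA.
  exact: (congr1 (fun y => (N ^_ t)%:R * y) (stage_step (Ordinal tN))).
have st0 : stage 0 = N`!%:R * \det (\matrix_(l, j) \sum_(v < M.+1) C (Phi l v) *
  V j 0 v).
  apply: (etrans _ (sum_det_det M (fun l n => C (Phi l n)) (fun l => V l 0))).
  apply: eq_big => [x|x _].
    by apply/andP; split; [apply/descP|apply/forallP].
  by rewrite /frozen_det; apply: eq_det_mul => l j; rewrite minn0.
transitivity (mcoeff m (mpolyX K (prefix 0) * stage 0)).
  have -> : prefix 0 = mnm0.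
    by apply/mnmP => q; rewrite mnm0E multinomE tnth_mktuple;
      case: fintype.split.
  rewrite st0; symmetry; apply: (etrans (mcoeff_monoM_nat _ _ _ _)).
  exact: (congr1 (fun y => N`!%:R * y) (mcoeff_mono0M _ _)).
apply: (etrans (step N (leqnn N))); rewrite ffactnn;
  apply: (congr1 (fun y => N`!%:R * y)).
have -> : prefix N = m.
  apply/mnmP => q; rewrite -(splitK q); case: (fintype.split q) => p /=.
    by rewrite prefixl ml ltn_ord.
  by rewrite prefixr mr ltn_ord.
have -> : stage N = C (\sum_(x | desc N x && pinned N x)
    \det (\matrix_(l, j) dops (par b 1 j.+1) (Phi l) (x j)) *
    \det (\matrix_(l, j) ddags (par b j.+1 N.+1) (Psi l) (x j))).
  apply: (etrans _ (esym (mpolyC_sum_det _ _ _ _))); apply: eq_bigr => x _.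
  rewrite /frozen_det; apply: eq_det_mul => l j;
    rewrite !mxE (minn_idPl (ltnW (ltn_ord j))).
    by rewrite /left_col parC dops_mpolyC.
  by rewrite /right_col parC gauged_nn ddags_mpolyC.
exact: mcoeff_monoMC.
Qed.

End CoefficientExtraction.

(** * The kernel *)

Section Kernel.
Variables (A : comNzRingType) (N n M : nat) (b : nat -> A)
  (g : nat -> nat -> A).
Variables (Phi Psi : 'I_N -> nat -> A) (W : 'M[A]_N) (pt : 'I_n -> nat * 'I_N).
Hypothesis pt_inj : injective pt.
Hypothesis pt_bound : forall u, ((pt u).1 + N < M)%N.
Hypothesis g_off : forall x (s : 'I_N), (forall u, pt u <> (x, s)) -> g s x = 1.

Lemma sum_points (F : nat -> 'I_N -> A) :
  (forall x s, (forall u, pt u <> (x, s)) -> F x s = 0) ->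
  \sum_u F (pt u).1 (pt u).2 = \sum_(s < N) \sum_(x < M) F x s.
Proof.
move=> F0; rewrite pair_bigA /=.
have ltM u : ((pt u).1 < M)%N by apply: leq_ltn_trans (pt_bound u);
  rewrite leq_addr.
pose q u : 'I_N * 'I_M := ((pt u).2, Ordinal (ltM u)).
have q_inj : injective q.
  move=> u v [e1 e2]; apply: pt_inj.
  by rewrite [pt u]surjective_pairing [pt v]surjective_pairing e1 e2.
rewrite [RHS](bigID (mem (codom q))) /= [X in _ + X]big1 ?addr0; last first.
  move=> [s x] /= /negP nq; apply: F0 => u ptu; case: nq; apply/codomP;
    exists u.
  by rewrite /q; congr pair; [|apply: val_inj]; rewrite /= ptu.
rewrite -big_uniq /=; last by rewrite map_inj_uniq // enum_uniq.
by rewrite big_map big_enum.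
Qed.

(** The amount subtracted in [sum_gauged_sub]: the effect of the gates on the Gram matrix. *)
Definition kernel_gram : 'M[A]_N := \matrix_(i, j) \sum_(t < N) \sum_(x < M)
  dressed b g (Phi i) t x * ((1 - g t x) * ddags (par b t.+1 N.+1) (Psi j) x).

Lemma kernel_gram_def i j : kernel_gram i j = \sum_(t < N) \sum_(x < M)
  dressed b g (Phi i) t x * ((1 - g t x) * ddags (par b t.+1 N.+1) (Psi j) x).
Proof. by rewrite mxE. Qed.

(** The matrix is [1 + U - L Y], where [U] comes from the indicator part of the kernel and strictly
    lowers the level. The dressed functions [L'] solve [(1 + U) L' = L], so [det_one_sub_dressed]
    applies. *)
Lemma det_kernel :
  \det (\matrix_(u, v) ((u == v)%:R -
    (- ((pt v).2 < (pt u).2)%N%:R *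
       ddags (par b (pt v).2.+1 (pt u).2.+1) (fun y => (y == (pt u).1)%:R)
         (pt v).1 +
     \sum_i \sum_j W j i * dops (par b 1 (pt u).2.+1) (Phi i) (pt u).1 *
       ddags (par b (pt v).2.+1 N.+1) (Psi j) (pt v).1) *
    (1 - g (pt v).2 (pt v).1))) = \det (1%:M - kernel_gram *m W).
Proof.
pose U : 'M[A]_n := \matrix_(u, v) (((pt v).2 < (pt u).2)%N%:R *
  ddags (par b (pt v).2.+1 (pt u).2.+1) (fun y => (y == (pt u).1)%:R) (pt v).1 *
  (1 - g (pt v).2 (pt v).1)).
pose L : 'M[A]_(n, N) := \matrix_(u, i) dops (par b 1 (pt u).2.+1) (Phi i)
  (pt u).1.
pose L' : 'M[A]_(n, N) := \matrix_(u, i) dressed b g (Phi i) (pt u).2 (pt u).1.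
pose Y : 'M[A]_(N, n) := \matrix_(i, v) \sum_j W j i *
  ddags (par b (pt v).2.+1 N.+1) (Psi j) (pt v).1 * (1 - g (pt v).2 (pt v).1).
rewrite (_ : \matrix_(u, v) _ = 1%:M + U - L *m Y); last first.
  apply/matrixP => u v; rewrite !mxE mulrDl opprD !mulNr opprK addrA;
    congr (_ + _ - _).
  rewrite mulr_suml; apply: eq_bigr => i _; rewrite !mxE mulr_suml mulr_sumr.
  by apply: eq_bigr => j _; ring.
rewrite (@det_one_sub_dressed _ _ _ (fun u => (pt u).2) U L L' Y); last 2 first.
- by move=> u v uv; rewrite mxE ltnNge uv !mul0r.
- apply/matrixP => u i; rewrite mulmxDl mul1mx !mxE (dops_dressed b g);
    congr (_ + _).
  (* Off the points [1 - g] vanishes, so the sum over points extends to the whole rectangle. *)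
  transitivity (\sum_(s < N) \sum_(y < M) (s < (pt u).2)%N%:R *
    ddags (par b s.+1 (pt u).2.+1) (fun y => (y == (pt u).1)%:R) y *
    (1 - g s y) * dressed b g (Phi i) s y).
    rewrite -(sum_points (F := fun y s => (s < (pt u).2)%N%:R *
      ddags (par b s.+1 (pt u).2.+1) (fun y => (y == (pt u).1)%:R) y *
      (1 - g s y) * dressed b g (Phi i) s y)).
      by apply: eq_bigr => v _; rewrite !mxE.
    by move=> x s /g_off ->; rewrite subrr mulr0 mul0r.
  rewrite [RHS](big_ord_widen N (fun s => dops (par b s.+1 (pt u).2.+1)
    (fun m => (1 - g s m) * dressed b g (Phi i) s m) (pt u).1));
      last exact: ltnW.
  rewrite [RHS]big_mkcond; apply: eq_bigr => s _.
  case: ifP => su; last by rewrite big1 // => y _; rewrite !mul0r.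
  have uM : ((pt u).1 < M)%N by apply: leq_ltn_trans (pt_bound u);
    rewrite leq_addr.
  transitivity (\sum_(y < M) ((1 - g s y) * dressed b g (Phi i) s y) *
    ddags (par b s.+1 (pt u).2.+1) (fun y => (y == (pt u).1)%:R) y).
    by apply: eq_bigr => y _; rewrite mul1r; ring.
  (* The indicator of [(pt u).1] has finite support and [pt_bound] leaves room for all factors, so
     there is no boundary term. *)
  rewrite (@sum_dops _ (par b s.+1 (pt u).2.+1)
    (fun y => (1 - g s y) * dressed b g (Phi i) s y) _ (pt u).1.+1).
  - rewrite (bigD1 (Ordinal uM)) //= eqxx mulr1 big1 ?addr0 // => y.
    by rewrite -val_eqE /= => /negPf ->; rewrite mulr0.
  - by move=> y yu; rewrite gtn_eqF.
  - by rewrite size_par; have := pt_bound u; have := ltn_ord (pt u).2; lia.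
(* The transpose of [Y L'] is [kernel_gram] times [W]. *)
rewrite -det_tr; congr (\det _); apply/matrixP => i' i; rewrite !mxE eq_sym.
congr (_ - _); transitivity (\sum_v \sum_j dressed b g (Phi i') (pt v).2
  (pt v).1 *
    ((1 - g (pt v).2 (pt v).1) * ddags (par b (pt v).2.+1 N.+1) (Psi j)
      (pt v).1) * W j i).
  apply: eq_bigr => v _; rewrite !mxE mulr_suml; apply: eq_bigr => j _; ring.
rewrite exchange_big; apply: eq_bigr => j _; rewrite -mulr_suml mxE;
  congr (_ * _).
rewrite -(sum_points (F := fun x t => dressed b g (Phi i') t x *
  ((1 - g t x) * ddags (par b t.+1 N.+1) (Psi j) x))) //.
by move=> x s /g_off ->; rewrite subrr mul0r mulr0.
Qed.

End Kernel.

Lemma kernel_gram_widen (A : comNzRingType) (N c M : nat) (b : nat -> A)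
    (g : nat -> nat -> A) (Phi Psi : 'I_N -> nat -> A) :
  (forall t n, (c <= n)%N -> g t n = 1) -> (c <= M)%N ->
  kernel_gram M b g Phi Psi = kernel_gram c b g Phi Psi.
Proof.
move=> g1 cM; apply/matrixP => i j; rewrite !mxE; apply: eq_bigr => t _.
rewrite [RHS](big_ord_widen M (fun x => dressed b g (Phi i) t x *
  ((1 - g t x) * ddags (par b t.+1 N.+1) (Psi j) x)) cM) [RHS]big_mkcond.
apply: eq_bigr => x _; case: ltnP => // cx.
by rewrite g1 // subrr mul0r mulr0.
Qed.

Section FiniteFormula.
Variables (K : numFieldType) (k N : nat).
Variables (i : 'I_k -> 'I_N) (a : 'I_k -> nat) (c : nat).
Hypothesis i_inj : injective i.
Hypothesis a_lt : forall p, (a p < c)%N.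
Variables (Phi Psi : 'I_N -> nat -> K) (b : nat -> K) (m : multinom (k + k)).
Hypothesis ml : forall p, m (lshift k p) = (N - (i p).+1)%N.
Hypothesis mr : forall p, m (rshift k p) = 1%N.
Local Notation C := (@mpolyC (k + k) K).
Local Notation bC := (fun s => C (b s)).
Local Notation PhiC := (fun j n => C (Phi j n)).
Local Notation PsiC := (fun j n => C (Psi j n)).

Lemma gate_eq1 t n : (c <= n)%N -> gate K i a t n = 1.
Proof. by move=> cn; apply: gate_far => p; exact: leq_trans (a_lt p) cn. Qed.

Lemma parC l r : par bC l r = map C (par b l r).
Proof. by rewrite /par -map_comp. Qed.

Lemma mpolyC_sum (I : finType) (F H : I -> K) :
  C (\sum_x F x * H x) = \sum_x C (F x) * C (H x).
Proof. by rewrite raddf_sum; apply: eq_bigr => x _; exact: mpolyCM. Qed.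

(** Equates the two evaluations of the gated Gram determinant for coordinates at most [M]. On the
    right only the ungated Gram sums depend on [M]. *)
Lemma sum_pinned M : (c + N <= M.+1)%N ->
  \sum_(x : {ffun 'I_N -> 'I_M.+1} | desc N x && pinned i a N x)
    \det (\matrix_(l, j) dops (par b 1 j.+1) (Phi l) (x j)) *
    \det (\matrix_(l, j) ddags (par b j.+1 N.+1) (Psi l) (x j)) =
  mcoeff m (\det (\matrix_(l, j)
    (C (\sum_(v < M.+1) Phi l v * ddags (par b 1 N.+1) (Psi j) v) -
     kernel_gram c bC (gate K i a) PhiC PsiC l j))).
Proof.
move=> cM; have nz : N`!%:R != 0 :> K by rewrite pnatr_eq0 -lt0n fact_gt0.
apply: (mulfI nz); rewrite -(mcoeff_det_gauged M a i_inj Phi Psi b ml mr).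
congr (_ * mcoeff m (\det _)); apply/matrixP => l j; rewrite [LHS]mxE [RHS]mxE.
rewrite (sum_gauged_sub bC (PhiC l) (PsiC j) gate_eq1 cM); congr (_ - _).
  rewrite mpolyC_sum; apply: eq_bigr => v _.
  by rewrite parC ddags_mpolyC.
rewrite -(kernel_gram_widen bC PhiC PsiC gate_eq1
  (leq_trans (leq_addr N c) cM)).
by rewrite kernel_gram_def.
Qed.

End FiniteFormula.

Import numFieldNormedType.Exports.

Local Open Scope classical_set_scope.
Local Open Scope complex_scope.

(** * Limits and unordered sums *)

Section Tends.
Variables (K : numFieldType) (T : Type) (F : set_system T).
Context {FF : Filter F}.
Implicit Types (u v : T -> K) (l : K).

(* [R[i]] carries its topology only under the alias [R[i]^o], hence a notion of
   convergence that does not refer to the topology. *)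
Definition tends u l := forall e : K, 0 < e ->
  \forall t \near F, `|l - u t| < e.

Lemma tendsP u l : tends u l <-> u @ F --> l.
Proof. by split => [H|/cvgrPdist_lt H]; [apply/cvgrPdist_lt|exact: H]. Qed.

Lemma tends_cst l : tends (fun=> l) l.
Proof. by apply/tendsP; exact: cvg_cst. Qed.

Lemma tendsD u v l l' : tends u l -> tends v l' ->
  tends (fun t => u t + v t) (l + l').
Proof. by move=> /tendsP ul /tendsP vl; apply/tendsP; exact: cvgD ul vl. Qed.

Lemma tendsB u v l l' : tends u l -> tends v l' ->
  tends (fun t => u t - v t) (l - l').
Proof. by move=> /tendsP ul /tendsP vl; apply/tendsP; exact: cvgB ul vl. Qed.

Lemma tendsM u v l l' : tends u l -> tends v l' ->
  tends (fun t => u t * v t) (l * l').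
Proof. by move=> /tendsP ul /tendsP vl; apply/tendsP; exact: cvgM ul vl. Qed.

Lemma tends_sum (I : Type) (r : seq I) (P : pred I) (u : I -> T -> K)
  (l : I -> K) :
  (forall i, P i -> tends (u i) (l i)) ->
  tends (fun t => \sum_(i <- r | P i) u i t) (\sum_(i <- r | P i) l i).
Proof.
move=> H; elim: r => [|i r IH].
  by under eq_fun do rewrite big_nil; rewrite big_nil; exact: tends_cst.
under eq_fun do rewrite big_cons; rewrite big_cons.
by have [Pi|_] := boolP (P i); [apply: tendsD => //; exact: H|].
Qed.

Lemma tends_squeeze0 u v : (forall t, `|u t| <= `|v t|) -> tends v 0 ->
  tends u 0.
Proof.
move=> uv H e /H; apply: filterS => t; rewrite !sub0r !normrN.
exact: le_lt_trans.
Qed.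

Lemma tends_squeeze_ge0 u v :
  (forall t, 0 <= u t <= v t) -> tends v 0 -> tends u 0.
Proof.
move=> uv; apply: tends_squeeze0 => t; have /andP[u0 uvt] := uv t.
by rewrite !ger0_norm // (le_trans u0).
Qed.

Lemma tends_near u v l : (\forall t \near F, u t = v t) -> tends u l ->
  tends v l.
Proof. by move=> uv H e /H; apply: filterS2 uv => t ->. Qed.

Lemma eq_tends u v l : u =1 v -> tends u l -> tends v l.
Proof. by move=> /funext ->. Qed.

End Tends.

Lemma tends_unique (K : numFieldType) (T : Type) (F : set_system T)
    {FF : ProperFilter F} (u : T -> K) l l' :
  tends F u l -> tends F u l' -> l = l'.
Proof.
move=> ul ul'; apply/eqP; rewrite -subr_eq0 -normr_eq0.
apply: contraT => nz; have e0 : 0 < `|l - l'| / 2.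
  by rewrite divr_gt0 // lt_def nz normr_ge0.
have [t [/= h1 h2]] := filter_ex (filterI (ul _ e0) (ul' _ e0)).
have := ltrD h1 h2; rewrite -splitr => /(le_lt_trans _) H.
suff /H : `|l - l'| <= `|l - u t| + `|l' - u t| by rewrite ltxx.
rewrite (distrC l'); apply: le_trans (ler_normD _ _).
by rewrite addrA subrK.
Qed.

#[local] Existing Instance totally_filter.

(** * Absolutely summable complex families *)

Section Csum.
Variables (R : realType) (T : choiceType).
Local Notation normc := ComplexField.Normc.normc.
Implicit Types (f g : T -> R[i]) (F : {fset T}).

Lemma psumE (V : zmodType) (f : T -> V) F : partial_sum f F = \sum_(x <- F) f x.
Proof. by rewrite /partial_sum big_seq_fsetE. Qed.

Lemma csum_eq f l : tends totally (partial_sum f) l -> csum f = l.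
Proof.
move=> H; apply: (@cvg_lim R[i]^o); first exact: norm_hausdorff.
exact: (proj2 (@cvgrPdist_lt R[i] R[i]^o _ _ _ (partial_sum f : _ -> R[i]^o) l)
  H).
Qed.

Lemma abs_summableP f :
  abs_summable f <-> exists B, forall F, \sum_(x <- F) normc (f x) <= B.
Proof.
have E F : (\sum_(x \in [set` F]) `|(normc (f x))%:E| =
  (\sum_(x <- F) normc (f x))%:E)%E.
  rewrite fsbig_finite //= set_fsetK -sumEFin; apply: eq_bigr => x _.
  by rewrite /= ger0_norm //; case: (f x) => ? ?; exact: sqrtr_ge0.
split=> [sf|[B HB]].
  exists (fine (\esum_(x in [set: T]) `|(normc (f x))%:E|)%E) => F.
  rewrite -lee_fin fineK; last by rewrite -summableE.
  rewrite -E; apply: esum_ge; exists [set` F]; last exact: lexx.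
  split; [exact: finite_fset|exact: subsetT].
rewrite /abs_summable /esum.summable; apply: (@le_lt_trans _ _ B%:E);
  last exact: ltry.
apply: ge_ereal_sup => _ [X [finX _] <-].
by rewrite -(fset_setK finX) E lee_fin.
Qed.

Lemma normc_ge0 (z : R[i]) : 0 <= normc z.
Proof. by case: z => ? ?; exact: sqrtr_ge0. Qed.

Lemma le_abs_summable (c : R) f g : 0 <= c ->
  (forall x, normc (f x) <= c * normc (g x)) ->
  abs_summable g -> abs_summable f.
Proof.
move=> c0 fg /abs_summableP[B HB]; apply/abs_summableP; exists (c * B) => F.
apply: le_trans (ler_wpM2l c0 (HB F)); rewrite mulr_sumr.
by apply: ler_sum => x _.
Qed.

Lemma tends_psum_ge0 (u : T -> R) B : (forall x, 0 <= u x) ->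
  (forall F, \sum_(x <- F) u x <= B) ->
  exists l, tends totally (partial_sum (fun x => (u x)%:C)) l%:C.
Proof.
move=> u0 uB; pose S := [set \sum_(x <- F) u x | F in [set: {fset T}]].
have hS : has_sup S.
  by split; [exists (\sum_(x <- fset0) u x);
    exists fset0|exists B => _ [F _ <-]].
exists (sup S) => e e0.
(* In the order on [R[i]], a positive number is real. *)
have eE : e = (complex.Re e)%:C.
  by move: e0; case: e => a b; rewrite ltcE /= => /andP[/eqP -> _].
have re0 : 0 < complex.Re e by move: e0; rewrite {1}eE -[0]/(0%:C) ltcR.
have [_ [F0 _ <-] HF0] := sup_adherent re0 hS.
exists F0 => // F /= F0F; rewrite psumE -(raddf_sum (real_complex R)) -raddfB
  /=.
have leS : \sum_(x <- F) u x <= sup S by apply: sup_upper_bound => //; exists F.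
rewrite normc_def /= expr0n addr0 sqrtr_sqr eE ltcR ger0_norm ?subr_ge0 //.
rewrite ltrBlDl -ltrBlDr; apply: (lt_le_trans HF0).
rewrite [leRHS](bigID (mem F0)) /= -[in leRHS]big_filter.
rewrite (perm_big (F0 : seq T) (r1 := [seq x <- F | x \in F0])).
  by rewrite lerDl sumr_ge0.
apply: uniq_perm; [by rewrite filter_uniq ?fset_uniq|exact: fset_uniq|].
move=> x; rewrite mem_filter andb_idr // => xF0.
by move: F0F => /fsubsetP; apply.
Qed.

Lemma normc_ge_part (z : R[i]) :
  `|complex.Re z| <= normc z /\ `|complex.Im z| <= normc z.
Proof.
case: z => a b /=; split; rewrite -sqrtr_sqr ler_wsqrtr //.
  by rewrite lerDl sqr_ge0.
by rewrite lerDr sqr_ge0.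
Qed.

(** Real and imaginary parts are treated separately; each, called [h], is the difference of the
    nonnegative families |h| + h and |h|, to which the supremum argument applies. *)
Lemma tends_psum f : abs_summable f -> tends totally (partial_sum f) (csum f).
Proof.
move=> /abs_summableP[B HB].
suff [l Hl] : exists l, tends totally (partial_sum f) l by rewrite (csum_eq Hl).
have H (h : R[i] -> R) : (forall z, `|h z| <= normc z) ->
    exists l, tends totally (partial_sum (fun x => (h (f x))%:C)) l.
  move=> hn.
  have [l1 H1] : exists l, tends totally
    (partial_sum (fun x => (`|h (f x)|)%:C)) l%:C.
    apply: (@tends_psum_ge0 _ B) => // F; apply: le_trans (HB F).
    by apply: ler_sum => x _.
  have [l2 H2] : exists l,
      tends totally (partial_sum (fun x => (`|h (f x)| + h (f x))%:C)) l%:C.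
    apply: (@tends_psum_ge0 _ (B + B)) => [x|F].
      by rewrite -[X in _ + X]opprK subr_ge0 -normrN ler_norm.
    apply: le_trans (lerD (HB F) (HB F)); rewrite -big_split /=.
    apply: ler_sum => x _; apply: lerD => //; apply: le_trans (hn _).
    exact: ler_norm.
  exists (l2%:C - l1%:C); apply: eq_tends (tendsB H2 H1) => F;
    rewrite !psumE -sumrB.
  by apply: eq_bigr => x _; rewrite -raddfB /= addrC addKr.
have [l1 H1] := H (@complex.Re R) (fun z => (normc_ge_part z).1).
have [l2 H2] := H (@complex.Im R) (fun z => (normc_ge_part z).2).
exists (l1 + 'i * l2); apply: eq_tends (tendsD H1 (tendsM (tends_cst 'i) H2)) =>
  F; rewrite !psumE mulr_sumr -big_split /=.
by apply: eq_bigr => x _; rewrite [RHS]complexE.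
Qed.

Lemma tends_psum_seq f (A : nat -> {fset T}) : abs_summable f ->
  (forall F, exists n0, forall n, (n0 <= n)%N -> F `<=` A n)%fset ->
  tends \oo (fun n => \sum_(x <- A n) f x) (csum f).
Proof.
move=> sf HA e e0; have [F0 _ HF0] := tends_psum sf e0.
have [n0 Hn0] := HA F0; exists n0 => // n /= n0n.
by have := HF0 _ (Hn0 n n0n); rewrite /= psumE.
Qed.

Lemma csum_fin f F : (forall x, x \notin F -> f x = 0) -> csum f =
  \sum_(x <- F) f x.
Proof.
move=> f0; apply: csum_eq => e e0; exists F => // G /= FG.
rewrite psumE; suff -> : \sum_(x <- G) f x =
  \sum_(x <- F) f x by rewrite subrr normr0.
rewrite (bigID (mem F)) /= [X in _ + X]big1 // addr0 -big_filter.
apply: perm_big.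
apply: uniq_perm; [by rewrite filter_uniq ?fset_uniq|exact: fset_uniq|].
move=> x; rewrite mem_filter andb_idr // => xF.
by move: FG => /fsubsetP; apply.
Qed.

End Csum.

(** * Boundary terms at infinity *)

Section Boundary.
Variable K : numFieldType.
Implicit Types (f h : nat -> K) (s : seq K) (c : K).

(** With these parameters [dop] and [ddag] have nonnegative coefficients and majorize the original
    operators in absolute value. *)
Definition nabs s := [seq - `|c| | c <- s].

Lemma dop_nabs c f n : dop (- `|c|) f n = f n + `|c| * f n.+1.
Proof. by rewrite /dop mulNr opprK. Qed.

Lemma ddag_nabs c f n : ddag (- `|c|) f n = f n + `|c| * f n.-1 * (1 <= n)%N%:R.
Proof. by rewrite /ddag !mulNr opprK. Qed.

Lemma dops_ge0 s f : (forall n, 0 <= f n) -> forall n, 0 <= dops (nabs s) f n.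
Proof.
move=> f0; elim: s => //= c s IH n.
by rewrite dop_nabs addr_ge0 // mulr_ge0.
Qed.

Lemma ddags_ge0 s f : (forall n, 0 <= f n) -> forall n, 0 <= ddags (nabs s) f n.
Proof.
move=> f0; elim: s => //= c s IH n.
by rewrite ddag_nabs addr_ge0 // !mulr_ge0.
Qed.

Lemma le_dops s f h : (forall n, f n <= h n) ->
  forall n, dops (nabs s) f n <= dops (nabs s) h n.
Proof.
move=> fh; elim: s => //= c s IH n.
by rewrite !dop_nabs lerD // ler_wpM2l.
Qed.

Lemma norm_dop c f n : `|dop c f n| <= dop (- `|c|) (fun k => `|f k|) n.
Proof. by rewrite dop_nabs /dop (le_trans (ler_normB _ _)) // normrM. Qed.

Lemma norm_dops s f n : `|dops s f n| <= dops (nabs s) (fun k => `|f k|) n.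
Proof.
elim: s n => //= c s IH n; apply: le_trans (norm_dop _ _ _) _.
by rewrite !dop_nabs lerD // ler_wpM2l.
Qed.

Lemma norm_ddags s f n : `|ddags s f n| <= ddags (nabs s) (fun k => `|f k|) n.
Proof.
elim: s n => //= c s IH n; rewrite ddag_nabs.
apply: le_trans (ler_normB _ _) _; rewrite !normrM lerD //.
by rewrite normr_nat ler_wpM2r // ler_wpM2l.
Qed.

(** By nonnegativity, every product in the expansion of the hypothesis tends to 0 by itself. The
    boundary term is a sum of such products with shifted indices, by induction on [s]. *)
Lemma tends_boundary s c f h : (forall n, 0 <= f n) -> (forall n, 0 <= h n) ->
  tends \oo (fun n => h n * dops (nabs (c :: s)) f n) 0 ->
  tends \oo (fun n => `|c| * f n.+1 * ddags (nabs s) h n) 0.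
Proof.
elim: s f => [|d s IH] f f0 h0 H.
  apply: (tends_squeeze_ge0 _ H) => n.
  by rewrite !mulr_ge0 //= dop_nabs mulrC ler_wpM2l // lerDr.
have HD n : dops (nabs (c :: s)) f n + `|d| * dops (nabs (c :: s)) f n.+1 =
    dops (nabs [:: c, d & s]) f n by rewrite /= dopC [RHS]dop_nabs.
have D0 : forall n, 0 <= dops (nabs (c :: s)) f n by exact: dops_ge0.
rewrite -[X in tends _ _ X]addr0; apply: eq_tends (tendsD (u := fun n =>
    `|c| * f n.+1 * ddags (nabs s) h n) (v := fun n =>
    `|c| * f n.+1 * (`|d| * ddags (nabs s) h n.-1 * (1 <= n)%N%:R)) _ _).
- by move=> n; rewrite /= ddag_nabs mulrDr.
- apply: IH => //; apply: (tends_squeeze_ge0 _ H) => n.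
  by rewrite mulr_ge0 ?D0 // andTb -HD ler_wpM2l // lerDl mulr_ge0.
(* The induction hypothesis is used a second time, for [f] modified by the factor of [d]; the shift
   operators commute, so the assumption is the given one. *)
have {}IH : tends \oo (fun n => `|c| * dop (- `|d|) f n.+1 * ddags (nabs s) h n)
  0.
  apply: IH => // [n|]; first by rewrite dop_nabs addr_ge0 // mulr_ge0.
  apply: eq_tends H => n; congr (_ * _).
  by rewrite dops_dop -HD dop_nabs.
(* The term with [h] at [n.-1] is treated with its index shifted by one: |d| f(n+2) is one of the
   two nonnegative terms of the modified function at n+1. *)
have {IH} : tends \oo (fun n => `|c| * f n.+2 * (`|d| * ddags (nabs s) h n)) 0.
  apply: (tends_squeeze_ge0 _ IH) => n.
  have X0 : 0 <= ddags (nabs s) h n by exact: ddags_ge0.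
  rewrite !mulr_ge0 //= dop_nabs mulrA ler_wpM2r // -mulrA ler_wpM2l //.
  by rewrite mulrC lerDr.
move=> H2 e /H2 [n0 _ Hn0]; exists n0.+1 => // -[|n] //= n0n.
by have := Hn0 n n0n; rewrite /= mulr1.
Qed.

(** Each factor changes sides at the cost of one boundary term, which [tends_boundary] controls. The
    hypothesis passes to [dop c f] by the triangle inequality. *)
Lemma tends_sum_by_parts s f h :
  tends \oo (fun n => `|h n| * dops (nabs s) (fun k => `|f k|) n) 0 ->
  tends \oo (fun M => \sum_(n < M) f n * ddags s h n -
                      \sum_(n < M) dops s f n * h n) 0.
Proof.
elim: s f => [|c s IH] f H.
  by apply: (eq_tends _ (tends_cst 0)) => n /=; rewrite subrr.
rewrite -[X in tends _ _ X]addr0; apply: eq_tends (tendsD (u := fun M =>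
    c * f M * (ddags s h M.-1 * (0 < M)%N%:R))
    (v := fun M => \sum_(n < M) dop c f n * ddags s h n -
                   \sum_(n < M) dops s (dop c f) n * h n) _ _).
- move=> M; cbv beta; rewrite -[ddags (c :: s) h]/(ddag c (ddags s h))
    sum_by_parts dops_dop.
  by rewrite -[dops (c :: s) f]/(dop c (dops s f)); ring.
- have /(_ s c) := @tends_boundary _ _ (fun k => `|f k|) (fun k => `|h k|).
  move=> /(_ (fun=> normr_ge0 _) (fun=> normr_ge0 _) H) H2 e /H2 [n0 _ Hn0].
  exists n0.+1 => // -[|n] //= n0n; have := Hn0 n n0n.
  apply: le_lt_trans; rewrite !sub0r !normrN mulr1 !normrM !normr_id.
  rewrite ler_wpM2l // (le_trans (norm_ddags _ _ _)) // ger0_norm //.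
  by apply: ddags_ge0.
apply: IH; apply: (tends_squeeze_ge0 _ H) => n.
rewrite mulr_ge0 ?dops_ge0 //= ler_wpM2l // -dops_dop.
by apply: le_dops => k; exact: norm_dop.
Qed.

End Boundary.

(** * Coefficientwise limits of polynomials *)

Section PolynomialLimits.
Variables (K : numFieldType) (n : nat) (T : Type) (F : set_system T).
Context {FF : Filter F}.
Implicit Types (p q : T -> mpoly n K) (P Q : mpoly n K).

Definition tendsC p P := forall m, tends F (fun t => mcoeff m (p t))
  (mcoeff m P).

Lemma tendsC_cst P : tendsC (fun=> P) P.
Proof. by move=> m; exact: tends_cst. Qed.

Lemma tendsC_mpolyC (u : T -> K) l : tends F u l ->
  tendsC (fun t => mpolyC n (u t)) (mpolyC n l).
Proof.
move=> ul m; rewrite mcoeffC; under eq_fun do rewrite mcoeffC.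
exact: tendsM ul (tends_cst _).
Qed.

Lemma tendsCB p q P Q : tendsC p P -> tendsC q Q ->
  tendsC (fun t => p t - q t) (P - Q).
Proof.
move=> pP qQ m; rewrite mcoeffB; under eq_fun do rewrite mcoeffB.
exact: tendsB.
Qed.

Lemma tendsCM p q P Q : tendsC p P -> tendsC q Q ->
  tendsC (fun t => p t * q t) (P * Q).
Proof.
move=> pP qQ m; rewrite mcoeffM; under eq_fun do rewrite mcoeffM.
by apply: tends_sum => k _; exact: tendsM.
Qed.

Lemma tendsC_sum (I : Type) (r : seq I) (p : I -> T -> mpoly n K)
  (P : I -> mpoly n K) :
  (forall i, tendsC (p i) (P i)) ->
  tendsC (fun t => \sum_(i <- r) p i t) (\sum_(i <- r) P i).
Proof.
move=> H m; rewrite raddf_sum; under eq_fun do rewrite raddf_sum.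
by apply: tends_sum => i _; exact: H.
Qed.

Lemma tendsC_prod (I : Type) (r : seq I) (p : I -> T -> mpoly n K)
  (P : I -> mpoly n K) :
  (forall i, tendsC (p i) (P i)) ->
  tendsC (fun t => \prod_(i <- r) p i t) (\prod_(i <- r) P i).
Proof.
move=> H; elim: r => [|i r IH].
  by under eq_fun do rewrite big_nil; rewrite big_nil; exact: tendsC_cst.
by under eq_fun do rewrite big_cons; rewrite big_cons; exact: tendsCM.
Qed.

Lemma tendsC_det N (p : T -> 'M[mpoly n K]_N) (P : 'M[mpoly n K]_N) :
  (forall i j, tendsC (fun t => p t i j) (P i j)) ->
  tendsC (fun t => \det (p t)) (\det P).
Proof.
move=> H; apply: tendsC_sum => s; apply: tendsCM; first exact: tendsC_cst.
by apply: tendsC_prod => i; exact: H.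
Qed.

End PolynomialLimits.

(** * The ensemble *)

Section Links.
Variables (R : realType) (beta : nat -> R[i]) (N : nat).
Local Notation normc := ComplexField.Normc.normc.

(* [beta N], which the ensemble does not involve, is set to 0: every level
   [0 <= t < N] is then followed by a shift operator. *)
Definition cut (s : nat) : R[i] := if (s < N)%N then beta s else 0.

Lemma par_cut m r : (r <= N)%N -> par cut m r = par beta m r.
Proof.
move=> rN; apply/eq_in_map => s; rewrite mem_index_iota => /andP[_ sr].
by rewrite /cut (leq_trans sr).
Qed.

Lemma DintE m r f : Dint beta m r f = dops (par beta m r) f.
Proof. by rewrite /dops /par foldr_map. Qed.

Lemma DdagintE m r f : Ddagint beta m r f = ddags (par beta m r) f.
Proof. by rewrite /ddags /par foldr_map. Qed.

Lemma Dint_cut t f : (t < N)%N -> Dint beta 1 t.+1 f = dops (par cut 1 t.+1) f.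
Proof. by move=> tN; rewrite DintE par_cut. Qed.

Lemma Ddagint_cut m f : (m <= N)%N -> Ddagint beta m N f =
  ddags (par cut m N.+1) f.
Proof.
move=> mN; rewrite par_rcons // /ddags foldr_rcons {1}/cut ltnn ddag0.
by rewrite par_cut // DdagintE.
Qed.

(** A row of [Tbeta] has at most two nonzero entries, so the convolution is a finite sum. *)
Lemma kconv_Tbeta c (f : nat -> nat -> R[i]) x y :
  kconv (Tbeta c) f x y = ddag c (f^~ y) x.
Proof.
rewrite /kconv /ddag; case: x => [|x].
  rewrite (@csum_fin _ _ _ [fset 0%N]%fset); last first.
    by move=> u; rewrite inE /Tbeta => /negPf ->; rewrite /= mulr0 subr0 mul0r.
  by rewrite big_seq_fset1 /Tbeta /= !mulr0 !subr0 mul1r.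
rewrite (@csum_fin _ _ _ [fset x.+1; x]%fset); last first.
  move=> u; rewrite !inE /Tbeta negb_or eqSS => /andP[/negPf -> /negPf ->].
  by rewrite mulr0 subr0 mul0r.
have e1 : (x.+1 == x) = false by rewrite gtn_eqF.
have e2 : (x == x.+1) = false by rewrite ltn_eqF.
rewrite big_fsetU1 ?inE ?e1 //= big_seq_fset1 /Tbeta !eqxx eqSS e1 e2 /=.
by ring.
Qed.

Lemma Tint_cut s t y x : (t < N)%N ->
  Tint beta s.+1 t.+1 y x = ddags (par cut s.+1 t.+1) (fun u => (u == x)%:R) y.
Proof.
move=> tN; rewrite par_cut // /Tint /par /ddags foldr_map.
elim: (index_iota _ _) y => [//|r l IH] y /=; rewrite kconv_Tbeta.
by congr (ddag _ _ _); apply/funext => u; exact: IH.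
Qed.

Lemma normC (z : R[i]) : `|z| = (normc z)%:C.
Proof. by rewrite normc_def; case: z. Qed.

End Links.

(** * Exhaustion of the configurations by boxes *)

Section Configurations.
Variable N : nat.

Definition unbox M (x : {ffun 'I_N -> 'I_M.+1}) : {ffun 'I_N -> nat} :=
  [ffun j => nat_of_ord (x j)].

Lemma unbox_inj M : injective (@unbox M).
Proof.
by move=> x y /ffunP xy; apply/ffunP => j; apply: val_inj; have := xy j;
  rewrite !ffunE.
Qed.

Lemma decreasing_unbox M (x : {ffun 'I_N -> 'I_M.+1}) : decreasing (unbox x) =
  desc N x.
Proof.
apply: eq_forallb => p; apply: eq_forallb => q.
by rewrite !ffunE ltn_ord.
Qed.

Definition box_configs M : {fset config N} :=
  [fset X in pmap insub [seq unbox x | x : {ffun 'I_N -> 'I_M.+1}]]%fset.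

Lemma sum_box (V : zmodType) M (F : {ffun 'I_N -> nat} -> V) :
  \sum_(X <- box_configs M) F (val X) =
  \sum_(x : {ffun 'I_N -> 'I_M.+1} | desc N x) F (unbox x).
Proof.
set s := [seq unbox x | x : {ffun 'I_N -> 'I_M.+1}].
have us : uniq (pmap (insub : _ -> option (config N)) s).
  by rewrite pmap_sub_uniq // map_inj_uniq ?enum_uniq //; exact: unbox_inj.
rewrite (perm_big (pmap insub s)); last first.
  by apply: uniq_perm; [exact: fset_uniq|exact: us|move=> X; rewrite inE].
rewrite -(big_map (val : config N -> _) xpredT F).
rewrite (pmap_filter (insubK _)).
rewrite big_filter /s big_map big_enum_cond; apply: eq_bigl => x.
rewrite -decreasing_unbox; by case: insubP => [u -> //|/negPf ->].
Qed.

Lemma box_configs_exhaust (G : {fset config N}) :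
  exists n0, forall n, (n0 <= n)%N -> (G `<=` box_configs n)%fset.
Proof.
(* The sum of all coordinates of all configurations in [G] bounds each of them. *)
exists (\sum_(X <- G) \sum_(j < N) val X j)%N => n Gn; apply/fsubsetP => X XG.
have ltX j : (val X j < n.+1)%N.
  rewrite ltnS; apply: leq_trans Gn; rewrite (big_fsetD1 X) //= (bigD1 j) //=.
  by rewrite -addnA leq_addr.
rewrite inE /= mem_pmap_sub; apply/mapP.
exists [ffun j => Ordinal (ltX j)]; first by rewrite mem_enum.
by apply/ffunP => j; rewrite !ffunE.
Qed.

End Configurations.

(** * The limit of the truncated Gram matrix *)

Section GramLimit.
Variables (R : realType) (N : nat) (Phi Psi : 'I_N -> nat -> R[i]).
Variable beta : nat -> R[i].
Hypothesis N_ge1 : (1 <= N)%N.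
Hypothesis series_cvg : series_converge Phi Psi beta.
Local Notation normc := ComplexField.Normc.normc.

Lemma tends_psum_nat (f : nat -> R[i]) : abs_summable f ->
  tends \oo (fun M => \sum_(n < M) f n) (csum f).
Proof.
move=> sf; apply: eq_tends (tends_psum_seq
  (A := fun M => [fset x in iota 0 M]%fset) sf _).
  move=> M; rewrite (perm_big (iota 0 M)) /=.
    by rewrite -[iota 0 M](_ : index_iota 0 M = _) ?big_mkord // /index_iota
      subn0.
  by apply: uniq_perm; [exact: fset_uniq|exact: iota_uniq|move=> x;
    rewrite inE].
move=> F; exists (\sum_(x <- F) x.+1)%N => n Fn; apply/fsubsetP => x xF.
rewrite inE /= mem_iota /=; apply: leq_trans Fn.
by rewrite (big_fsetD1 x) //= leq_addr.
Qed.

Lemma tends_term0 (f : nat -> R[i]) : abs_summable f -> tends \oo f 0.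
Proof.
move=> sf; have H := tends_psum_nat sf.
have HS : tends \oo (fun M => \sum_(n < M.+1) f n) (csum f).
  by move=> e /H [n0 _ Hn0]; exists n0 => // n /= n0n; apply: Hn0; exact: leqW.
rewrite -[X in tends _ _ X](subrr (csum f)).
by apply: eq_tends (tendsB HS H) => M; rewrite big_ord_recr /= [LHS]addrC addKr.
Qed.

Lemma Gram_bound i j :
  abs_summable (fun k => `|Psi j k| * dops (nabs (par beta 1 N))
    (fun l => `|Phi i l|) k).
Proof.
have := series_cvg.1 i j; congr (abs_summable _); apply/funext => k.
by rewrite DintE /nabs /par -map_comp.
Qed.

Lemma Gram_summable i j : abs_summable
  (fun k => Psi j k * Dint beta 1 N (Phi i) k).
Proof.
apply: (@le_abs_summable _ _ 1) (Gram_bound i j) => // k.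
rewrite mul1r -lecR -!normC DintE !normrM normr_id ler_wpM2l //.
rewrite [leRHS]ger0_norm ?norm_dops //.
by apply: dops_ge0 => l; exact: normr_ge0.
Qed.

(** Terms of an absolutely convergent series tend to 0; applied to [Gram_bound], this is the
    hypothesis of [tends_sum_by_parts]. So the truncated sums have the same limit whether the
    operators act on [Psi] or on [Phi]. *)
Lemma tends_Gram i j :
  tends \oo (fun M => \sum_(n < M.+1) Phi i n * ddags (par (cut beta N) 1 N.+1)
    (Psi j) n)
    (Gram Phi Psi beta i j).
Proof.
suff H : tends \oo (fun M => \sum_(n < M) Phi i n *
    ddags (par (cut beta N) 1 N.+1) (Psi j) n) (Gram Phi Psi beta i j).
  by move=> e /H [n0 _ Hn0]; exists n0 => // n /= n0n; apply: Hn0; exact: leqW.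
rewrite mxE -Ddagint_cut // DdagintE.
have H1 := tends_sum_by_parts (tends_term0 (Gram_bound i j)).
have H2 := tends_psum_nat (Gram_summable i j).
rewrite -[X in tends _ _ X]add0r; apply: eq_tends (tendsD H1 H2) => M /=.
rewrite -addrA -[RHS]addr0; congr (_ + _); rewrite addrC -sumrB big1 // => n _.
by rewrite DintE mulrC subrr.
Qed.

End GramLimit.

(** * The limits of the marginal sums and of the partition function *)

Section MarginalLimit.
Variables (R : realType) (N k : nat) (Phi Psi : 'I_N -> nat -> R[i]).
Variable beta : nat -> R[i].
Variables (i : {ffun 'I_k -> 'I_N}) (a : {ffun 'I_k -> nat}) (c : nat).
Hypothesis N_ge1 : (1 <= N)%N.
Hypothesis series_cvg : series_converge Phi Psi beta.
Hypothesis i_inj : injective i.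
Hypothesis a_lt : forall p, (a p < c)%N.

Local Notation b := (cut beta N).
Local Notation P := (mpoly (k + k) R[i]).
Local Notation C := (@mpolyC (k + k) R[i]).

(* G - G_g, which does not depend on the truncation M. *)
Definition correction : 'M[P]_N := kernel_gram c (fun s => C (b s))
  (gate R[i] i a)
  (fun j n => C (Phi j n)) (fun j n => C (Psi j n)).

Lemma zwmonomial_lshift p : zwmonomial i (lshift k p) = (N - (i p).+1)%N.
Proof. by rewrite multinomE tnth_mktuple -[lshift k p]/(unsplit (inl p))
  unsplitK. Qed.

Lemma zwmonomial_rshift p : zwmonomial i (rshift k p) = 1%N.
Proof. by rewrite multinomE tnth_mktuple -[rshift k p]/(unsplit (inr p))
  unsplitK. Qed.

Lemma indic_marginal (X : config N) :
  \1_[set X | marginal i X = a] X = ([ffun p => val X (i p)] == a)%:R :> R[i].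
Proof. by rewrite indicE; congr (_%:R); congr nat_of_bool; apply/idP/eqP;
  rewrite inE. Qed.

Lemma sum_box_weight M : (c + N <= M.+1)%N ->
  \sum_(X <- box_configs N M) \1_[set X | marginal i X = a] X * weight Phi Psi
    beta X =
  mcoeff (zwmonomial i) (\det (\matrix_(l, j)
    (C (\sum_(v < M.+1) Phi l v * ddags (par b 1 N.+1) (Psi j) v) - correction l
      j))).
Proof.
move=> cM.
rewrite -(sum_pinned i_inj a_lt Phi Psi b zwmonomial_lshift zwmonomial_rshift
  cM).
pose F (X : {ffun 'I_N -> nat}) : R[i] := ([ffun p => X (i p)] == a)%:R *
  (\det (\matrix_(l, j) Dint beta 1 j.+1 (Phi l) (X j)) *
   \det (\matrix_(l, j) Ddagint beta j.+1 N (Psi l) (X j))).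
rewrite (eq_bigr (fun X => F (val X))); last first.
  by move=> X _; rewrite indic_marginal.
rewrite (sum_box M F) [RHS]big_mkcondr; apply: eq_bigr => x _; rewrite /F.
have -> : ([ffun p => unbox x (i p)] == a) = pinned i a N x.
  apply/eqP/forallP => [/ffunP H p|H].
    by apply/implyP => _; rewrite -(H p) !ffunE.
  by apply/ffunP => p; have := H p; rewrite ltn_ord !ffunE => /eqP.
case: ifP => _; last by rewrite mul0r.
rewrite mul1r; apply: eq_det_mul => l j; rewrite ffunE.
  by rewrite (Dint_cut beta _ (ltn_ord j)).
by rewrite (Ddagint_cut beta _ (ltn_ord j)).
Qed.

(** The identity [sum_box_weight] is exact for large boxes, and a coefficient of the determinant
    depends continuously on the Gram entries. *)
Lemma tends_marginal : tends \oo
  (fun M => \sum_(X <- box_configs N M)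
     \1_[set X | marginal i X = a] X * weight Phi Psi beta X)
  (mcoeff (zwmonomial i) (\det (\matrix_(l, j)
     (C (Gram Phi Psi beta l j) - correction l j)))).
Proof.
have H : tends \oo (fun M => mcoeff (zwmonomial i) (\det (\matrix_(l, j)
    (C (\sum_(v < M.+1) Phi l v * ddags (par b 1 N.+1) (Psi j) v) - correction l
      j))))
    (mcoeff (zwmonomial i) (\det (\matrix_(l, j)
     (C (Gram Phi Psi beta l j) - correction l j)))).
  apply: tendsC_det => l j.
  have H : tendsC \oo (fun M => C (\sum_(v < M.+1) Phi l v *
      ddags (par b 1 N.+1) (Psi j) v) - correction l j)
      (C (Gram Phi Psi beta l j) - correction l j).
    apply: tendsCB; last exact: tendsC_cst.
    by apply: tendsC_mpolyC; exact: tends_Gram.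
  move=> m; rewrite mxE; apply: (eq_tends _ (H m)) => M.
  by rewrite [X in _ = mcoeff _ X]mxE.
apply: tends_near H; exists (c + N)%N => // M /= cM.
by rewrite sum_box_weight // leqW.
Qed.

End MarginalLimit.

Section PartitionFunction.
Variables (R : realType) (N : nat) (Phi Psi : 'I_N -> nat -> R[i]).
Variable beta : nat -> R[i].
Hypothesis N_ge1 : (1 <= N)%N.
Hypothesis series_cvg : series_converge Phi Psi beta.

Lemma partition_function_det : partition_function Phi Psi beta =
  \det (Gram Phi Psi beta).
Proof.
pose i : {ffun 'I_0 -> 'I_N} := [ffun=> Ordinal N_ge1].
pose a : {ffun 'I_0 -> nat} := [ffun=> 0%N].
have i_inj : injective i by case.
(* Vacuous, so [c = 0] is allowed, and then the correction is an empty sum. *)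
have a_lt (p : 'I_0) : (a p < 0)%N by case: p.
have H1 := tends_marginal N_ge1 series_cvg i_inj a_lt.
have H2 := tends_psum_seq series_cvg.2 (@box_configs_exhaust N).
rewrite /partition_function (tends_unique H2 (l' := \det (Gram Phi Psi beta)))
  //.
have -> : \det (Gram Phi Psi beta) = mcoeff (zwmonomial i) (\det (\matrix_(l, j)
    (mpolyC (0 + 0) (Gram Phi Psi beta l j) - correction Phi Psi beta i a 0 l
      j))).
  have -> : \matrix_(l, j) (mpolyC (0 + 0) (Gram Phi Psi beta l j) -
      correction Phi Psi beta i a 0 l j) =
        map_mx (mpolyC (0 + 0) (R := R[i])) (Gram Phi Psi beta).
    apply/matrixP => l j; rewrite [LHS]mxE [RHS]mxE /correction kernel_gram_def
      big1 ?subr0 //.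
    by move=> t _; rewrite big_ord0.
  rewrite det_map_mx mcoeffC (_ : _ == _) ?mulr1 //.
  by apply/eqP/mnmP => -[].
apply: eq_tends H1 => M; apply: eq_bigr => X _.
rewrite indic_marginal (_ : _ == _) ?mul1r //.
by apply/eqP/ffunP => -[].
Qed.

End PartitionFunction.

Lemma sub_gate (A : comNzRingType) (I : finType) (z w : I -> A)
  (B C : I -> bool) (d x : A) :
  d - \sum_p z p * (x * (B p)%:R) - \sum_p w p * (x * (C p)%:R) =
  d - x * (1 - (1 - \sum_p (z p * (B p)%:R + w p * (C p)%:R))).
Proof.
rewrite subKr -addrA -opprD -big_split mulr_sumr; congr (_ - _).
by apply: eq_bigr => p _ /=; ring.
Qed.

Lemma mxE_sub_sum (A : comNzRingType) n (I : finType) (B C : I -> 'M[A]_n) u v :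
  (1%:M - \sum_p B p - \sum_p C p) u v =
  (u == v)%:R - \sum_p B p u v - \sum_p C p u v.
Proof. by rewrite !mxE !summxE. Qed.

Lemma mxE_scale_diag (A : comNzRingType) n (z : A) (B : 'M[A]_n) (d : 'I_n -> A)
  u v :
  (z *: (B *m diag_mx (\row_w d w))) u v = z * (B u v * d v).
Proof. by rewrite mul_mx_diag !mxE. Qed.

(** * The determinant of the theorem in terms of gates *)

Section TestDeterminant.
Variables (R : realType) (N k : nat).
Variables (i : {ffun 'I_k -> 'I_N}) (a : {ffun 'I_k -> nat}).

Lemma mem_Bset x (s t : 'I_N) n : ((x, t) \in Bset s n) = (s == t) && (x < n)%N.
Proof.
apply/imfsetP/andP => [[y /= yn [-> ->]]|[/eqP -> xn]].
  by rewrite eqxx; move: yn; rewrite mem_iota.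
by exists x => //=; rewrite mem_iota.
Qed.

Lemma mem_Cset x (s t : 'I_N) n : ((x, t) \in Cset s n) = (s == t) && (x == n).
Proof. by rewrite inE xpair_eqE andbC eq_sym. Qed.

Lemma Fset_gate x (s : 'I_N) : (forall u, Fpoint (i := i) (a := a) u <> (x, s))
  ->
  gate R[i] i a s x = 1.
Proof.
move=> H; have {H} nF : (x, s) \notin Fset i a.
  apply/negP => xF; apply: (H (enum_rank (FSetSub xF))).
  by rewrite /Fpoint enum_rankK.
rewrite /gate big1 ?subr0 // => p _.
have : (x, s) \notin (Bset (i p) (a p) `|` Cset (i p) (a p))%fset.
  by apply: contra nF => xp; apply/bigfcupP; exists p; rewrite ?mem_enum.
rewrite in_fsetU mem_Bset mem_Cset negb_or -val_eqE =>
  /andP[/negPf -> /negPf ->].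
by rewrite !mulr0 addr0.
Qed.

(** All indices lie in [Fset], so its indicator matrix is the identity, and the two sums over [p]
    combine into [1 - gate] at the column point. *)
Lemma zwmatrixE (K : nat * 'I_N -> nat * 'I_N -> R[i]) u v :
  zwmatrix i a K u v = (u == v)%:R -
    mpolyC (k + k) (K (Fpoint u) (Fpoint v)) *
    (1 - gate R[i] i a (Fpoint v).2 (Fpoint v).1).
Proof.
have mB p : (Fpoint v \in Bset (i p) (a p)) =
    (i p == (Fpoint v).2 :> nat) && ((Fpoint v).1 < a p)%N.
  by rewrite {1}[Fpoint v]surjective_pairing mem_Bset -val_eqE eq_sym.
have mC p : (Fpoint v \in Cset (i p) (a p)) =
    (i p == (Fpoint v).2 :> nat) && ((Fpoint v).1 == a p).
  by rewrite {1}[Fpoint v]surjective_pairing mem_Cset -val_eqE eq_sym.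
rewrite /zwmatrix.
have -> : chi R i a (Fset i a) = 1%:M.
  rewrite /chi -diag_const_mx; congr diag_mx; apply/rowP => w;
    rewrite [LHS]mxE [RHS]mxE.
  by rewrite /Fpoint fsvalP.
rewrite [X in _ - X]mul1mx [X in _ - X - _]mul1mx.
apply: (etrans (mxE_sub_sum _ _ _ _)).
apply: (etrans _ (sub_gate _ _ _ _ _ _)).
congr (_ - _ - _).
  apply: eq_bigr => p _.
  apply: (etrans (mxE_scale_diag _ _ _ _ _)).
  by rewrite [Kmx _ _ _ u v]mxE mB.
apply: eq_bigr => p _.
apply: (etrans (mxE_scale_diag _ _ _ _ _)).
by rewrite [Kmx _ _ _ u v]mxE mC.
Qed.

End TestDeterminant.

Section TestFormula.
Variables (R : realType) (N k : nat) (Phi Psi : 'I_N -> nat -> R[i]).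
Variable beta : nat -> R[i].
Variables (i : {ffun 'I_k -> 'I_N}) (a : {ffun 'I_k -> nat}) (c : nat).
Hypothesis N_ge1 : (1 <= N)%N.
Hypothesis a_lt : forall p, (a p < c)%N.

Local Notation b := (cut beta N).
Local Notation C := (@mpolyC (k + k) R[i]).
Local Notation bC := (fun s => C (b s)).

Lemma mpolyC_K2d (u v : nat * 'I_N) : C (K2d Phi Psi beta u v) =
  - (v.2 < u.2)%N%:R * ddags (par bC v.2.+1 u.2.+1) (fun y => (y == u.1)%:R) v.1
      +
  \sum_l \sum_j map_mx C (invmx (Gram Phi Psi beta)) j l *
    dops (par bC 1 u.2.+1) (fun n => C (Phi l n)) u.1 *
    ddags (par bC v.2.+1 N.+1) (fun n => C (Psi j n)) v.1.
Proof.
case: u v => [x t] [y s]; rewrite /K2d mpolyCD; congr (_ + _).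
  rewrite mpolyCM mpolyCN mpolyC_nat; congr (_ * _).
  rewrite (Tint_cut _ _ _ _ (ltn_ord t)) -ddags_mpolyC -parC;
    congr (ddags _ _ _).
  by apply/funext => n; rewrite mpolyC_nat.
rewrite raddf_sum; apply: eq_bigr => l _; rewrite /= raddf_sum;
  apply: eq_bigr => j _.
rewrite /= !mpolyCM (Dint_cut _ _ (ltn_ord t)) (Ddagint_cut _ _ (ltn_ord s)).
by rewrite -dops_mpolyC -ddags_mpolyC -!parC mxE.
Qed.

Lemma Fpoint_lt u : ((Fpoint (i := i) (a := a) u).1 < c)%N.
Proof.
have : Fpoint u \in Fset i a by rewrite /Fpoint fsvalP.
move=> /bigfcupP[p _]; rewrite [Fpoint u]surjective_pairing in_fsetU mem_Bset
  mem_Cset.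
by case/orP => /andP[_]; [move=> /ltn_trans; apply; exact: a_lt|move=> /eqP ->;
  exact: a_lt].
Qed.

Lemma det_zwmatrix : \det (zwmatrix i a (K2d Phi Psi beta)) =
  \det (1%:M - correction Phi Psi beta i a c *m map_mx C
    (invmx (Gram Phi Psi beta))).
Proof.
have g1 t n : (c <= n)%N -> gate R[i] i a t n = 1 by exact: gate_eq1.
have pt_inj : injective (Fpoint (i := i) (a := a)).
  by move=> u v /val_inj /enum_val_inj.
(* [det_kernel] is used with truncation [c + N]; the correction is the same as for [c], as the gates
   are 1 from [c] on. *)
have pt_bound u : ((Fpoint (i := i) (a := a) u).1 + N < c + N)%N.
  by rewrite ltn_add2r Fpoint_lt.
rewrite /correction -(kernel_gram_widen _ _ _ g1 (leq_addr N c)).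
rewrite -(det_kernel bC (fun j n => C (Phi j n)) (fun j n => C (Psi j n))
  (map_mx C (invmx (Gram Phi Psi beta))) pt_inj pt_bound
    (@Fset_gate R N k i a)).
congr (\det _); apply/matrixP => u v; apply: (etrans (zwmatrixE _ _ _)).
rewrite [RHS]mxE mpolyC_K2d.
by [].
Qed.

Lemma det_Gram_correction : \det (Gram Phi Psi beta) != 0 ->
  \det (\matrix_(l, j) (C (Gram Phi Psi beta l j) - correction Phi Psi beta i a
    c l j)) =
  \det (zwmatrix i a (K2d Phi Psi beta)) * C (\det (Gram Phi Psi beta)).
Proof.
move=> G0; have GU : Gram Phi Psi beta \in unitmx by rewrite unitmxE unitfE.
rewrite det_zwmatrix -(det_map_mx C) -det_mulmx; congr (\det _).
rewrite mulmxBl mul1mx -mulmxA -map_mxM mulVmx // map_mx1 mulmx1.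
by apply/matrixP => l j; rewrite [LHS]mxE [RHS]mxE [X in _ = X + _]mxE
  [X in _ = _ + X]mxE.
Qed.

End TestFormula.

Section Measures.
Variables (R : realType) (N : nat) (Phi Psi : 'I_N -> nat -> R[i]).
Variable beta : nat -> R[i].
Hypothesis series_cvg : series_converge Phi Psi beta.
Local Notation normc := ComplexField.Normc.normc.
Local Notation Z := (partition_function Phi Psi beta).

Lemma measure_summable (A : set (config N)) :
  abs_summable (fun X => \1_A X * (weight Phi Psi beta X / Z)).
Proof.
apply: (@le_abs_summable _ _ (normc Z^-1)) series_cvg.2 => [|X].
  exact: normc_ge0.
rewrite indicE; case: (_ \in _); rewrite ?mul1r ?mul0r; last first.
  by rewrite ComplexField.Normc.normc0 mulr_ge0 ?normc_ge0.
by rewrite ComplexField.Normc.normcM mulrC.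
Qed.

Lemma measure_of_sum (I : finType) (Q : pred I) (A : set (config N))
  (B : I -> set (config N)) :
  (forall X, \1_A X = \sum_(j | Q j) \1_(B j) X :> R[i]) ->
  measure_of Phi Psi beta A = \sum_(j | Q j) measure_of Phi Psi beta (B j).
Proof.
move=> AB; have H : tends totally
    (fun F => \sum_(j | Q j) partial_sum
      (fun X => \1_(B j) X * (weight Phi Psi beta X / Z)) F)
    (\sum_(j | Q j) measure_of Phi Psi beta (B j)).
  by apply: tends_sum => j _; apply: tends_psum; exact: measure_summable.
apply: csum_eq; apply: eq_tends H => F; rewrite psumE.
under eq_bigr do rewrite psumE; rewrite exchange_big; apply: eq_bigr => X _.
by rewrite AB mulr_suml.
Qed.

End Measures.

(** The box sums of the weights converge to the coefficient times [det G]; since [Z = det G],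
    normalization leaves the coefficient alone. *)
Lemma measure_marginal (R : realType) (N : nat) (N_ge1 : (1 <= N)%N)
    (Phi Psi : 'I_N -> nat -> R[i]) (beta : nat -> R[i])
    (series_cvg : series_converge Phi Psi beta)
    (Z_neq0 : partition_function Phi Psi beta != 0)
    (k : nat) (i : {ffun 'I_k -> 'I_N}) (a : {ffun 'I_k -> nat}) :
  injective i ->
  measure_of Phi Psi beta [set X | marginal i X = a] =
  mcoeff (zwmonomial i) (\det (zwmatrix i a (K2d Phi Psi beta))).
Proof.
move=> i_inj; have ZG := partition_function_det N_ge1 series_cvg.
have a_lt p : (a p < \sum_q (a q).+1)%N by rewrite (bigD1 p) //= leq_addr.
have H1 := tends_marginal N_ge1 series_cvg i_inj a_lt.
rewrite det_Gram_correction -?ZG // [X in mcoeff _ X]mulrC mcoeffCM in H1.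
have H2 := tends_psum_seq (measure_summable series_cvg
  [set X | marginal i X = a])
  (@box_configs_exhaust N).
apply: (tends_unique H2).
set L := mcoeff _ _ in H1 *; rewrite (_ : L =
  (partition_function Phi Psi beta * L) /
  partition_function Phi Psi beta); last by rewrite mulrAC mulfV ?mul1r.
apply: eq_tends (tendsM H1 (tends_cst _)) => M.
by rewrite /= mulr_suml; apply: eq_bigr => X _; rewrite -mulrA.
Qed.

(** * Marginals and containment *)

Section IncreasingMaps.
Variables (N k : nat).
Implicit Types (i : {ffun 'I_k -> 'I_N}).

Lemma increasingP i :
  reflect (forall p q : 'I_k, (p < q)%N -> (i p < i q)%N) (increasing i).
Proof.
apply: (iffP forallP) => [H p q pq|H p]; last first.
  by apply/forallP => q; apply/implyP; exact: H.
by have /forallP /(_ q) /implyP := H p; apply.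
Qed.

Lemma increasing_inj i : increasing i -> injective i.
Proof.
move=> /increasingP H p q e; apply: val_inj; apply/eqP.
by case: ltngtP => // /H; rewrite e ltnn.
Qed.

Let ltN : rel 'I_N := fun u v => (u < v)%N.

Lemma sorted_enum_ord n : sorted (fun u v : 'I_n => (u < v)%N) (enum 'I_n).
Proof. by have := iota_ltn_sorted 0 n; rewrite -val_enum_ord sorted_map. Qed.

Lemma increasing_codom i : increasing i -> sorted ltN (codom i).
Proof.
move=> /increasingP H; rewrite /codom /image_mem sorted_map.
by apply: sub_sorted (sorted_enum_ord k) => p q; exact: H.
Qed.

(** An increasing map is the sorted enumeration of its image. *)
Lemma increasing_uniq i j : increasing i -> increasing j ->
  codom i =i codom j -> i = j.
Proof.
move=> hi hj ij.
have e : codom i = codom j.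
  apply: (irr_sorted_eq (leT := ltN)) => //.
  - by move=> u v w; exact: ltn_trans.
  - by move=> u; exact: ltnn.
  - exact: increasing_codom.
  - exact: increasing_codom.
by apply/ffunP => p; apply: ((eq_in_map _ _ _).2 e); rewrite mem_enum.
Qed.

Lemma increasing_enum (S : {set 'I_N}) : #|S| = k ->
  exists2 i : {ffun 'I_k -> 'I_N}, increasing i & codom i =i S.
Proof.
move=> Sk; have sk : size (enum S) = k by rewrite -cardE.
have srt : sorted ltN (enum S).
  rewrite {1}/enum_mem -enumT; apply: sorted_filter;
    last exact: sorted_enum_ord.
  by move=> u v w; exact: ltn_trans.
pose t := tcast sk (in_tuple (enum S)).
have tE : tval t = enum S by rewrite val_tcast.
exists [ffun p => tnth t p].
  apply/increasingP => p q pq; have x0 : 'I_N by exact: tnth t p.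
  rewrite !ffunE !(tnth_nth x0) tE.
  by apply: (sorted_ltn_nth _ _ srt) => //; rewrite ?inE ?sk //; move=> u v w;
    exact: ltn_trans.
move=> u; rewrite -[RHS]mem_enum -tE; apply/codomP/tnthP => -[p ->];
  exists p => //;
  by rewrite ffunE.
Qed.

End IncreasingMaps.

(** Let [S] be the set of positions at which [X] takes a value of [a]. If all values occur, [S] has
    [k] elements, as [X] and [a] are injective, and exactly one increasing map has image [S].
    Otherwise every term vanishes. *)
Lemma contains_marginals (R : nzRingType) (N k : nat) (a : {ffun 'I_k -> nat})
  (X : config N) :
  injective a ->
  \1_[set X : config N | forall p : 'I_k, exists j : 'I_N, val X j = a p] X =
  \sum_(i : {ffun 'I_k -> 'I_N} | increasing i)
     \1_[set X | range (marginal i X) = range a] X :> R.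
Proof.
move=> a_inj.
have X_inj : injective (val X).
  move=> u v e; have /forallP dX := valP X; apply: val_inj; apply/eqP.
  case: ltngtP => // uv; last first.
    by have /forallP /(_ u) /implyP /(_ uv) := dX v; rewrite e ltnn.
  by have /forallP /(_ v) /implyP /(_ uv) := dX u; rewrite e ltnn.
pose S := [set j : 'I_N | val X j \in codom a]%SET.
have rangeP (i : {ffun 'I_k -> 'I_N}) :
    range (marginal i X) = range a <->
    (codom i =i S /\ (forall p, exists j, val X j = a p)).
  split=> [e|[iS cX]].
    have cX p : exists q, val X (i q) = a p.
      have : range a (a p) by exists p.
      by rewrite -e => -[q _ <-]; exists q; rewrite ffunE.
    split; last by move=> p; have [q Hq] := cX p; exists (i q).
    move=> j; rewrite inE; apply/codomP/codomP => [[q ->]|[p Xj]].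
      have : range (marginal i X) (val X (i q)) by exists q; rewrite ?ffunE.
      by rewrite e => -[p _ <-]; exists p.
    by have [q Hq] := cX p; exists q; apply: X_inj; rewrite Xj -Hq.
  apply/seteqP; split=> y [p _ <-].
    rewrite ffunE; have : i p \in S by rewrite -iS codom_f.
    by rewrite inE => /codomP[q ->]; exists q.
  have [j Xj] := cX p; have : j \in S by rewrite inE Xj codom_f.
  by rewrite -iS => /codomP[q jq]; exists q => //; rewrite ffunE -jq.
rewrite indicE; have [/set_mem /= cX|/negP nX] := boolP (_ \in _); last first.
  rewrite big1 // => i _; rewrite indicE;
    case: (boolP (_ \in _)) => // /set_mem /rangeP[_ cX].
  by case: nX; apply/mem_set.
have Sk : #|S| = k.
  have /choice[f fX] : forall p, exists j, val X j = a p by [].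
  rewrite -[RHS]card_ord -(card_codom (f := f)); last first.
    by move=> p q e; apply: a_inj; rewrite -!fX e.
  apply: eq_card => j; rewrite inE; apply/codomP/codomP => [[p Xj]|[p ->]].
    by exists p; apply: X_inj; rewrite Xj fX.
  by exists p; rewrite fX.
have [i inc_i iS] := increasing_enum Sk.
rewrite (bigD1 i) //= indicE mem_set; last exact/rangeP.
rewrite big1 ?addr0 // => j /andP[inc_j ji]; rewrite indicE.
case: (boolP (_ \in _)) => // /set_mem /rangeP[jS _].
by case/eqP: ji; apply: increasing_uniq => // u; rewrite jS iS.
Qed.

Theorem proposition2p7 (R : realType) (N : nat) (N_ge1 : (1 <= N)%N)
    (Phi Psi : 'I_N -> nat -> R[i]) (beta : nat -> R[i])
    (series_cvg : series_converge Phi Psi beta)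
    (Z_neq0 : partition_function Phi Psi beta != 0) :
  (forall (k : nat) (i : {ffun 'I_k -> 'I_N}) (a : {ffun 'I_k -> nat}),
     (1 <= k <= N)%N -> increasing i -> decreasing a ->
     measure_of Phi Psi beta [set X | marginal i X = a] =
     mcoeff (zwmonomial i) (\det (zwmatrix i a (K2d Phi Psi beta)))) /\
  (forall (k : nat) (a : {ffun 'I_k -> nat}),
     (1 <= k)%N -> injective a ->
     measure_of Phi Psi beta
       [set X : config N | forall p : 'I_k, exists j : 'I_N, val X j = a p] =
     \sum_(i : {ffun 'I_k -> 'I_N} | increasing i)
        measure_of Phi Psi beta [set X | range (marginal i X) = range a]).
Proof.
split=> [k i a _ inc_i _|k a _ a_inj].
  by apply: measure_marginal => //; exact: increasing_inj.
by apply: measure_of_sum => // X; exact: contains_marginals.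
Qed.
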